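(* Let $S$ be a round two-sphere in $\mathbb{HP}^1\cong S^4$ with a chosen conformal structure, let $S$ also denote its twistor lift (a projective line in $\mathbb{CP}^3$) and $Sj$ the twistor lift with the opposite conformal structure, and let $Q^2_S=\mathbb{P}(\{[S],[Sj]\}^{\perp})\cap Q^4$. Let $\pi_S:Q^2_S\to S\cong\mathbb{CP}^1$ send a line of $\mathbb{CP}^3$ meeting both $S$ and $Sj$ to its intersection point with $S$. (a) If $\varphi:\mathbb{Z}^2\to Q^2_S$ is a discrete conic net, then $\pi_S\circ\varphi:\mathbb{Z}^2\to S\cong\mathbb{CP}^1$ is a complex cross-ratio net: for every elementary face, the cross-ratio $[\pi_S\varphi(m+1,n),\pi_S\varphi(m,n),\pi_S\varphi(m,n+1),\pi_S\varphi(m+1,n+1)]\in\mathbb{C}$ equals the Steiner cross-ratio of $\varphi(m+1,n),\varphi(m,n),\varphi(m,n+1),\varphi(m+1,n+1)$ on the conic in which the plane of that face meets $Q^4$. (b) Let $p:\mathbb{Z}\to S$ be a discrete curve of points of the sphere $S$ (viewed as real points of $Q^2_S$), let $\lambda\in\mathbb{C}$, and let $\psi:\mathbb{Z}^2\to S\cong\mathbb{CP}^1$ be a complex cross-ratio evolution of $p$ by $\lambda$, i.e. $\psi(k,0)=p(k)$ and $[\psi(k+1,n),\psi(k,n),\psi(k,n+1),\psi(k+1,n+1)]=\lambda$ for all $k,n$. Then there is a unique discrete conjugate net $\varphi:\mathbb{Z}^2\to Q^2_S$ extending $p$ (with $\varphi(k,0)$ the real point over $p(k)$ and $\varphi(0,n)$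 the real point over $\psi(0,n)$) all of whose faces have Steiner cross-ratio $\lambda$, and it satisfies $\pi_S\circ\varphi=\psi$ (assuming the face conics encountered are irreducible).
   Context: $\mathbb{H}$ denotes the quaternions ($i^2=j^2=k^2=-1$, $jk=i$), $\mathbb{C}=\mathrm{span}_{\mathbb{R}}\{1,i\}$, $\mathbb{H}=\mathbb{C}\oplus j\mathbb{C}$. $\mathbb{H}^2$ is a right $\mathbb{H}$-vector space, identified with $\mathbb{C}^4$ by restricting scalars; right multiplication by $j$ is $\mathbb{C}$-antilinear ($vzj=vj\bar z$). $\mathbb{HP}^1=\{v\mathbb{H}\}\cong S^4$, $\mathbb{CP}^3=\mathbb{P}(\mathbb{C}^4)$. The twistor projection is $\tau:\mathbb{CP}^3\to\mathbb{HP}^1$, $v\mathbb{C}\mapsto v\mathbb{H}$; the twistor fibre over $v\mathbb{H}$ is the projective line through $[v],[vj]$. The Plücker quadric $Q^4=\{[\alpha]\in\mathbb{P}(\Lambda^2\mathbb{C}^4):\alpha\wedge\alpha=0\}$; $[v\wedge w]$ is identified with the projective line through $[v],[w]$. The symmetric bilinear form $(\alpha,\beta)\mapsto\alpha\wedge\beta\in\Lambda^4\mathbb{C}^4\cong\mathbb{C}$ defines $\perp$. The antilinear extension of $v\wedge w\mapsto vj\wedge wj$ induces a real structure $j$ on $Q^4$ whose fixed (''real'') points are the twistor fibres $[v\wedge vj]$, identified with points $v\mathbb{H}$ of $S^4$. A round two-sphere is the image under a Möbius transformation (induced by $GL(2,\mathbb{H})$) of a real 2-plane in an affine chart of $\mathbb{HP}^1$;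 with a conformal structure it equals $\{l:Sl=l\}$ for some $S\in\mathrm{End}_{\mathbb{H}}(\mathbb{H}^2)$, $S^2=-1$, and its twistor lift is $\mathbb{P}\{v:Sv=vi\}$; the lift for the opposite conformal structure is its image under $j$. $Q^2_S$ is the set of lines of $\mathbb{CP}^3$ meeting both $S$ and $Sj$; its real points are the twistor fibres over points of the sphere $S$. Cross-ratio on $\mathbb{CP}^1$: $[z_1,z_2,z_3,z_4]=\frac{(z_1-z_2)(z_3-z_4)}{(z_2-z_3)(z_4-z_1)}$ (so $[\infty,1,0,\lambda]=\lambda$). Steiner cross-ratio of four points on an irreducible plane conic: the cross-ratio of their images under projection from a fixed point of the conic onto a line in the plane of the conic. A discrete conjugate net is a map $\varphi:\mathbb{Z}^2\to\mathbb{CP}^n$ such that the images of the four vertices of each elementary face lie in a projective plane; a discrete conic net in a quadric is a discrete conjugate net into the quadric such that each face plane meets the quadric in an irreducible conic. *)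

(* Defs.v *)
(* Concrete model of the twistor / Pluecker setting.
   C : numClosedFieldType (e.g. the complex numbers), with conjugation conj
   and imaginary unit 'i.
   H^2 = C^4 : a vector v = (z1,w1,z2,w2) represents the quaternionic vector
   (z1 + j w1, z2 + j w2).  Right multiplication by a complex scalar is the
   usual scalar multiplication; right multiplication by j is the antilinear
   map  Jq (z,w) = (-conj w, conj z)  (since (z + j w) j = -conj w + j conj z).
   Lambda^2 C^4 = C^6 with Pluecker coordinates in the order
   01, 02, 03, 12, 13, 23. *)
From HB Require Import structures.
From mathcomp Require Import all_boot all_order all_algebra.
Set Implicit Arguments. Unset Strict Implicit. Unset Printing Implicit Defensive.
Import Order.TTheory GRing.Theory Num.Theory.
Local Open Scope ring_scope.

Section Defs.
Variable C : numClosedFieldType.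

(* ---- quaternionic structure on C^4 ---- *)
Definition jpartner (i : 'I_4) : 'I_4 := inord (if odd i then i.-1 else i.+1).

(* right multiplication by j *)
Definition Jq (v : 'cV[C]_4) : 'cV[C]_4 :=
  \col_(i < 4) (if odd i then (v (jpartner i) 0)^* else - (v (jpartner i) 0)^*).

(* S is an H-linear endomorphism of H^2 (C-linear and commuting with right
   multiplication by j) with S^2 = -1 *)
Definition quat_cpx_str (S : 'M[C]_4) : Prop :=
  (forall v, S *m Jq v = Jq (S *m v)) /\ S *m S = - 1%:M.

(* v spans a point of the twistor lift  P{v : S v = v i} *)
Definition twL (S : 'M[C]_4) (v : 'cV[C]_4) : Prop := S *m v = 'i *: v.

(* ---- Pluecker coordinates ---- *)
Definition pfst (i : 'I_6) : 'I_4 := inord (nth 0%N [:: 0; 0; 0; 1; 1; 2]%N i).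
Definition psnd (i : 'I_6) : 'I_4 := inord (nth 0%N [:: 1; 2; 3; 2; 3; 3]%N i).

Definition wedge (u v : 'cV[C]_4) : 'cV[C]_6 :=
  \col_(i < 6) (u (pfst i) 0 * v (psnd i) 0 - u (psnd i) 0 * v (pfst i) 0).

Definition psign (i : 'I_6) : C := if (val i == 1%N) || (val i == 4%N) then -1 else 1.

(* the symmetric bilinear form  (a, b) |-> a /\ b  in Lambda^4 C^4 = C *)
Definition pform (a b : 'cV[C]_6) : C :=
  \sum_(i < 6) psign i * a i 0 * b (rev_ord i) 0.

(* ---- linear algebra helpers ---- *)
Definition in_span {n} (s : seq 'cV[C]_n) (v : 'cV[C]_n) : Prop :=
  exists cs : seq C, size cs = size s /\ v = \sum_(i < size s) cs`_i *: s`_i.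

Definition indep2 {n} (a b : 'cV[C]_n) : Prop :=
  forall s t : C, s *: a + t *: b = 0 -> s = 0 /\ t = 0.

(* equality of projective points *)
Definition peq {n} (u v : 'cV[C]_n) : Prop :=
  u != 0 /\ v != 0 /\ exists t : C, u = t *: v.

(* ---- projective line CP^1 and cross-ratio ---- *)
(* points of CP^1 (and values in C u {oo}) are nonzero pairs up to scale *)
Definition peq1 (a b : C * C) : Prop :=
  a != (0, 0) /\ b != (0, 0) /\ a.1 * b.2 = a.2 * b.1.

Definition det2 (a b : C * C) : C := a.1 * b.2 - a.2 * b.1.

(* homogeneous version of (z1-z2)(z3-z4) / ((z2-z3)(z4-z1)) *)
Definition cr (z1 z2 z3 z4 : C * C) : C * C :=
  (det2 z1 z2 * det2 z3 z4, det2 z2 z3 * det2 z4 z1).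

(* cross-ratio (value c in C u {oo}) of four points on a projective line
   in P(C^n), computed in any projective coordinate of that line *)
Definition crLine {n} (x1 x2 x3 x4 : 'cV[C]_n) (c : C * C) : Prop :=
  exists a b : 'cV[C]_n, indep2 a b /\
  exists z1 z2 z3 z4 : C * C,
    [/\ x1 = z1.1 *: a + z1.2 *: b, x2 = z2.1 *: a + z2.2 *: b,
        x3 = z3.1 *: a + z3.2 *: b, x4 = z4.1 *: a + z4.2 *: b
      & peq1 (cr z1 z2 z3 z4) c].

(* ---- quadrics, conics ---- *)
(* Q^2_S = P({[S],[Sj]}^perp) /\ Q^4 *)
Definition Q2S (S : 'M[C]_4) (a : 'cV[C]_6) : Prop :=
  [/\ a != 0, pform a a = 0 &
      forall u v, twL S u -> twL S v ->
        pform a (wedge u v) = 0 /\ pform a (wedge (Jq u) (Jq v)) = 0].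

(* pi_S : the line a meets the twistor lift S in the point x *)
Definition piS (S : 'M[C]_4) (a : 'cV[C]_6) (x : 'cV[C]_4) : Prop :=
  [/\ x != 0, twL S x & exists y, a = wedge x y].

(* the real point of Q^4 (twistor fibre) over the point of S^4 given by x *)
Definition realpt (x : 'cV[C]_4) : 'cV[C]_6 := wedge x (Jq x).

(* the points of s lie in a projective plane (rank <= 3) *)
Definition coplanar (s : seq 'cV[C]_6) : Prop :=
  exists cs : seq C, size cs = size s /\ has (fun c => c != 0) cs /\
    \sum_(i < size s) cs`_i *: s`_i = 0.

(* the quadric Q^4 meets the span of s in an irreducible conic: the
   restriction of the quadratic form to the span is not a product of two
   linear forms *)
Definition irredConic (s : seq 'cV[C]_6) : Prop :=
  ~ exists l1 l2 : 'rV[C]_6, forall v, in_span s v ->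
      pform v v = (l1 *m v) 0 0 * (l2 *m v) 0 0.

(* Steiner cross-ratio (value c) of x1..x4 on the conic in which their
   plane meets Q^4: project from a point o of the conic (distinct from the
   x_i) onto a line <a,b> of the plane not through o *)
Definition steinerCR (x1 x2 x3 x4 : 'cV[C]_6) (c : C * C) : Prop :=
  let s := [:: x1; x2; x3; x4] in
  exists o a b : 'cV[C]_6,
    [/\ o != 0, pform o o = 0, in_span s o,
        (forall x, x \in s -> ~ in_span [:: x] o) &
    [/\ in_span s a, in_span s b, indep2 a b, ~ in_span [:: a; b] o &
    exists y1 y2 y3 y4 : 'cV[C]_6,
      (forall yx : 'cV[C]_6 * 'cV[C]_6,
         yx \in [:: (y1, x1); (y2, x2); (y3, x3); (y4, x4)] ->
         [/\ yx.1 != 0, in_span [:: a; b] yx.1 & in_span [:: o; yx.2] yx.1])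
      /\ crLine y1 y2 y3 y4 c]].

(* the four vertices of the face (m,n), in the order of the paper *)
Definition faceIdx (m n : int) : seq (int * int) :=
  [:: (m + 1, n); (m, n); (m, n + 1); (m + 1, n + 1)].

Definition faceV (phi : int -> int -> 'cV[C]_6) (m n : int) : seq 'cV[C]_6 :=
  [seq phi mn.1 mn.2 | mn <- faceIdx m n].

(* face of a discrete conic net *)
Definition conicFace (phi : int -> int -> 'cV[C]_6) (m n : int) : Prop :=
  coplanar (faceV phi m n) /\ irredConic (faceV phi m n).

Definition steinerFace (phi : int -> int -> 'cV[C]_6) (m n : int) (c : C * C) : Prop :=
  steinerCR (phi (m + 1) n) (phi m n) (phi m (n + 1)) (phi (m + 1) (n + 1)) c.

(* ---- Cauchy-problem bookkeeping for part (b) ---- *)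
(* the vertex of face (m,n) farthest from the coordinate axes *)
Definition farCorner (m n : int) : int * int :=
  (if 0 <= m then m + 1 else m, if 0 <= n then n + 1 else n).

(* the three vertices of face (m,n) known before the face is constructed *)
Definition nearV (phi : int -> int -> 'cV[C]_6) (m n : int) : seq 'cV[C]_6 :=
  [seq phi mn.1 mn.2 | mn <- faceIdx m n & mn != farCorner m n].

Definition betw0 (a b : int) : bool := if 0 <= b then (0 <= a) && (a <= b) else (b <= a) && (a < 0).

(* face (m',n') lies in the rectangle between the axes and face (m,n) *)
Definition inRect (m' n' m n : int) : bool := betw0 m' m && betw0 n' n.

End Defs.

(* Main.v *)
Require Import Defs.
From HB Require Import structures.
From mathcomp Require Import ring zify.
From mathcomp Require Import all_boot all_order all_algebra.
Set Implicit Arguments. Unset Strict Implicit. Unset Printing Implicit Defensive.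
Import Order.TTheory GRing.Theory Num.Theory.
Local Open Scope ring_scope.

(** The [i]-eigenspace [E] of [S] and its image [Ej] are complementary planes of
    [C^4], so a line meeting both is [x /\ y] with [x] in [E], [y] in [Ej], and
    [Q^2_S] is the Segre image of [P(E) x P(Ej)]; there the form is
    [(x (x) y, x' (x) y') |-> kap det(x, x') det(y, y')].
    Contracting the second factor with [y0] is a linear map to [E] that kills
    [x0 (x) y0]: it realises the projection of a conic from its point
    [x0 (x) y0], so the Steiner cross-ratio of four points of an irreducible
    plane section is the cross-ratio of their [E]-components, and likewise of
    their [Ej]-components. Conversely, four points whose components have the
    same cross-ratio in both factors are coplanar. Hence a conjugate net with
    constant Steiner cross-ratio [lambda] is a pair of cross-ratio evolutions by
    [lambda], one in [P(E)] (which is [psi]) and one in [P(Ej)] with conjugate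
    Cauchy data; a cross-ratio evolution determines the fourth vertex of a face
    from three distinct ones, which irreducibility guarantees. *)

(** Irreducibility is supplied only for faces of a net that is defined on all of [int * int] and is
    already good on the faces nearer to the axes. The second factor must therefore exist everywhere
    before any of its faces is known to be nondegenerate: it is defined by a total recursion with a
    default value, and an induction over faces then shows that the default never occurs.
    Irreducibility enters in one form: three isotropic vectors spanning the section are pairwise
    non-orthogonal, which says at once that their components are distinct in both factors. Since
    points are vectors up to scale and [crLine] and [steinerCR] choose coordinates existentially,
    every comparison of cross-ratios reduces to following four scalars and one determinant through
    [det2]. Both factors evolve with the same [lam], although their Cauchy data are conjugate;
    conjugation would turn [lam] into its conjugate, so for non-real [lam] no face has four real
    vertices. *)

(** * Spans of lists of vectors *)

Section Span.
Context {C : numClosedFieldType} {n : nat}.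
Implicit Types (s t : seq 'cV[C]_n) (u v : 'cV[C]_n).

Lemma in_span_nil v : in_span [::] v <-> v = 0.
Proof.
split; first by case=> [cs [_ ->]]; rewrite big_ord0.
by move=> ->; exists [::]; rewrite big_ord0.
Qed.

(** Replaces the indexed sum of the definition by a recursion on the list, so that the closure
    properties of spans become inductions. *)
Lemma in_span_cons a s v :
  in_span (a :: s) v <-> exists c w, in_span s w /\ v = c *: a + w.
Proof.
split.
  case=> [[|c cs] [] //= [scs] ->]; rewrite big_ord_recl /=.
  exists c, (\sum_(i < size s) cs`_i *: s`_i); split=> //.
  by exists cs.
case=> c [w [[cs [scs ->]] ->]]; exists (c :: cs) => /=.
by rewrite scs big_ord_recl.
Qed.

Lemma in_span1 a v : in_span [:: a] v <-> exists c, v = c *: a.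
Proof.
rewrite in_span_cons; split=> [[c [w [/in_span_nil -> ->]]]|[c ->]].
  by exists c; rewrite addr0.
by exists c, 0; rewrite in_span_nil addr0.
Qed.

Lemma in_span2 a b v :
  in_span [:: a; b] v <-> exists c d, v = c *: a + d *: b.
Proof.
rewrite in_span_cons; split=> [[c [w [/in_span1[d ->] ->]]]|[c [d ->]]].
  by exists c, d.
by exists c, (d *: b); rewrite in_span1; split=> //; exists d.
Qed.

Lemma in_span3 a b c v :
  in_span [:: a; b; c] v <-> exists x y z, v = x *: a + y *: b + z *: c.
Proof.
rewrite in_span_cons; split=> [[x [w [/in_span2[y [z ->]] ->]]]|[x [y [z ->]]]].
  by exists x, y, z; rewrite addrA.
by exists x, (y *: b + z *: c); rewrite in_span2 addrA; split=> //; exists y, z.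
Qed.

Lemma in_span0 s : in_span s 0.
Proof.
elim: s => [|a s IH]; first exact/in_span_nil.
by rewrite in_span_cons; exists 0, 0; rewrite scale0r addr0.
Qed.

Lemma in_spanD s u v : in_span s u -> in_span s v -> in_span s (u + v).
Proof.
elim: s u v => [|a s IH] u v; first by rewrite !in_span_nil => -> ->; rewrite addr0.
rewrite !in_span_cons => -[c [w [hw ->]]] [d [z [hz ->]]].
by exists (c + d), (w + z); split; [exact: IH | rewrite scalerDl addrACA].
Qed.

Lemma in_spanZ s k v : in_span s v -> in_span s (k *: v).
Proof.
elim: s v => [|a s IH] v; first by rewrite !in_span_nil => ->; rewrite scaler0.
rewrite !in_span_cons => -[c [w [hw ->]]].
by exists (k * c), (k *: w); split; [exact: IH | rewrite scalerDr scalerA].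
Qed.

Lemma in_span_mem s v : v \in s -> in_span s v.
Proof.
elim: s => //= a s IH; rewrite inE in_span_cons => /orP[/eqP-> | /IH h].
  by exists 1, 0; rewrite scale1r addr0; split=> //; exact: in_span0.
by exists 0, v; rewrite scale0r add0r.
Qed.

Lemma in_span_sub s t v :
  (forall x, x \in s -> in_span t x) -> in_span s v -> in_span t v.
Proof.
elim: s v => [|a s IH] v h; first by rewrite in_span_nil => ->; exact: in_span0.
rewrite in_span_cons => -[c [w [hw ->]]].
apply: in_spanD; first by apply/in_spanZ/h; rewrite mem_head.
by apply: IH => // x xs; apply: h; rewrite inE xs orbT.
Qed.

End Span.

(** * The form on bivectors and irreducible sections *)

Section Pform.
Context {C : numClosedFieldType}.
Implicit Types (a b c : 'cV[C]_6).

Lemma pformDl a b c : pform (a + b) c = pform a c + pform b c.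
Proof.
by rewrite /pform -big_split /=; apply: eq_bigr => i _; rewrite !mxE; ring.
Qed.

Lemma pformZl k a b : pform (k *: a) b = k * pform a b.
Proof.
by rewrite /pform mulr_sumr; apply: eq_bigr => i _; rewrite !mxE; ring.
Qed.

Lemma pformC a b : pform a b = pform b a.
Proof.
rewrite /pform (reindex_inj rev_ord_inj); apply: eq_bigr => i _.
rewrite rev_ordK; have -> : psign C (rev_ord i) = psign C i.
  by case: i => [[|[|[|[|[|[|//]]]]]] hi]; rewrite /psign.
by ring.
Qed.

Lemma pformDr a b c : pform a (b + c) = pform a b + pform a c.
Proof. by rewrite pformC pformDl !(pformC a). Qed.

Lemma pformZr k a b : pform a (k *: b) = k * pform a b.
Proof. by rewrite pformC pformZl (pformC a). Qed.

Lemma pform0l a : pform 0 a = 0.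
Proof. by rewrite -(scale0r 0) pformZl mul0r. Qed.

(** Linear forms in [irredConic] are row vectors; this turns the polar of a point into one of
    them. *)
Lemma pform_row b : exists l : 'rV[C]_6, forall a, (l *m a) 0 0 = pform a b.
Proof.
exists (\row_i (psign C i * b (rev_ord i) 0)) => a.
by rewrite mxE /pform; apply: eq_bigr => i _; rewrite mxE; ring.
Qed.

(* If [p a b = 0] then, for [v] in the span of the isotropic vectors [a], [b],
   [c], [pform v v] is a multiple of the product of [pform v c] with either
   [pform v a] or [pform v b]. *)
Lemma irredConic_pform_neq0 a b c :
  irredConic [:: a; b; c] -> pform a a = 0 -> pform b b = 0 -> pform c c = 0 ->
  pform a b != 0.
Proof.
move=> irr aa bb cc; apply/eqP => ab; apply: irr.
have [lc hlc] := pform_row c; have [la hla] := pform_row a.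
have [lb hlb] := pform_row b.
case: (eqVneq (pform a c) 0) => [ac | ac]; last first.
  exists ((2 / pform a c) *: la), lc => v /in_span3[x [y [z ->]]].
  rewrite -scalemxAl mxE hla hlc.
  rewrite !(pformDl, pformDr, pformZl, pformZr) aa bb cc.
  rewrite (pformC b a) (pformC c a) (pformC c b) ab; field; exact: ac.
case: (eqVneq (pform b c) 0) => [bc | bc]; last first.
  exists ((2 / pform b c) *: lb), lc => v /in_span3[x [y [z ->]]].
  rewrite -scalemxAl mxE hlb hlc.
  rewrite !(pformDl, pformDr, pformZl, pformZr) aa bb cc.
  rewrite (pformC b a) (pformC c a) (pformC c b) ab; field; exact: bc.
exists 0, 0 => v /in_span3[x [y [z ->]]]; rewrite mul0mx mxE mul0r.
rewrite !(pformDl, pformDr, pformZl, pformZr) aa bb cc.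
by rewrite (pformC b a) (pformC c a) (pformC c b) ab ac bc; ring.
Qed.

(** A factorisation on the larger span restricts to the smaller one. Hence a face is irreducible as
    soon as three of its vertices are. *)
Lemma irredConic_sub (s t : seq 'cV[C]_6) :
  (forall x, x \in s -> in_span t x) -> irredConic s -> irredConic t.
Proof.
move=> st irr [l1 [l2 h]]; apply: irr; exists l1, l2 => v sv.
by apply: h; apply: in_span_sub sv.
Qed.

End Pform.

(** * Cross-ratios in homogeneous coordinates *)

Section Pairs.
Context {C : numClosedFieldType}.
Implicit Types (x y z w c : C * C).

Lemma det2C x y : det2 x y = - det2 y x.
Proof. by rewrite /det2; ring. Qed.

Lemma det2xx x : det2 x x = 0.
Proof. by rewrite /det2; ring. Qed.

Lemma det2Zr k x y : det2 x (k * y.1, k * y.2) = k * det2 x y.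
Proof. by rewrite /det2 /=; ring. Qed.

Lemma pair_neq0 x : (x != (0, 0)) = (x.1 != 0) || (x.2 != 0).
Proof. by case: x => a b; rewrite xpair_eqE negb_and. Qed.

Lemma det2_eq0 x y : y != (0, 0) -> det2 x y = 0 ->
  exists k, x = (k * y.1, k * y.2).
Proof.
rewrite pair_neq0 => hy xy.
have {}xy : x.1 * y.2 = x.2 * y.1 by apply/eqP; rewrite -subr_eq0; apply/eqP.
case/orP: hy => h; [exists (x.1 / y.1) | exists (x.2 / y.2)];
  rewrite (surjective_pairing x) /=; congr pair; rewrite ?mulfVK //.
  by rewrite mulrAC xy mulfK.
by rewrite mulrAC -xy mulfK.
Qed.

Lemma det2_trans x y z : y != (0, 0) -> det2 x y = 0 -> det2 y z = 0 ->
  det2 x z = 0.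
Proof.
move=> hy /(det2_eq0 hy)[k ->]; rewrite det2C => h.
by rewrite det2C det2Zr (_ : det2 z y = 0) ?mulr0 ?oppr0 // -[LHS]opprK h oppr0.
Qed.

Lemma det2_ndeg x : x != (0, 0) -> exists y, det2 x y != 0.
Proof.
rewrite pair_neq0 => /orP[h | h]; [exists (0, 1) | exists (1, 0)];
  by rewrite /det2 /= ?mulr0 ?mulr1 ?subr0 ?sub0r ?oppr_eq0.
Qed.

Lemma peq1Z k z c : k != 0 -> peq1 (k * z.1, k * z.2) c <-> peq1 z c.
Proof.
move=> k0; rewrite /peq1 !pair_neq0 /= !mulf_eq0 !(negPf k0) /= -!mulrA.
by split=> -[h1 [h2 h3]]; do !split => //; [exact: (mulfI k0) | rewrite h3].
Qed.

(* The common ratio [(m1 m2 m3 m4) / D^2] scales both entries of [cr]. *)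
Lemma peq1_cr_transfer x1 x2 x3 x4 w1 w2 w3 w4 m1 m2 m3 m4 D c :
  m1 != 0 -> m2 != 0 -> m3 != 0 -> m4 != 0 -> D != 0 ->
  m1 * m2 * det2 x1 x2 = D * det2 w1 w2 ->
  m3 * m4 * det2 x3 x4 = D * det2 w3 w4 ->
  m2 * m3 * det2 x2 x3 = D * det2 w2 w3 ->
  m4 * m1 * det2 x4 x1 = D * det2 w4 w1 ->
  peq1 (cr x1 x2 x3 x4) c <-> peq1 (cr w1 w2 w3 w4) c.
Proof.
move=> m10 m20 m30 m40 D0 h12 h34 h23 h41.
have M0 : m1 * m2 * m3 * m4 != 0 by rewrite !mulf_neq0.
have DD0 : D * D != 0 by rewrite mulf_neq0.
rewrite -(peq1Z _ c M0) -(peq1Z (cr w1 w2 w3 w4) c DD0) /cr /=.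
have -> : m1 * m2 * m3 * m4 * (det2 x1 x2 * det2 x3 x4) =
          (m1 * m2 * det2 x1 x2) * (m3 * m4 * det2 x3 x4) by ring.
have -> : m1 * m2 * m3 * m4 * (det2 x2 x3 * det2 x4 x1) =
          (m2 * m3 * det2 x2 x3) * (m4 * m1 * det2 x4 x1) by ring.
rewrite h12 h34 h23 h41.
by rewrite (mulrACA D) (mulrACA D (det2 w2 w3)).
Qed.

Lemma cr_swap12 z1 z2 z3 z4 : cr z2 z1 z4 z3 = cr z1 z2 z3 z4.
Proof. by rewrite /cr /det2; congr pair; ring. Qed.

Lemma cr_swap13 z1 z2 z3 z4 : cr z3 z4 z1 z2 = cr z1 z2 z3 z4.
Proof. by rewrite /cr /det2; congr pair; ring. Qed.

Lemma cr_swap14 z1 z2 z3 z4 : cr z4 z3 z2 z1 = cr z1 z2 z3 z4.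
Proof. by rewrite /cr /det2; congr pair; ring. Qed.

(** Cleared of denominators, the equation [cr z1 z2 z3 z4 = lam] is linear in [z4]: it says that
    [z4] is proportional to this vector. The first argument is the vertex between [z1] and [z3]. *)
Definition fourth (lam : C) z2 z1 z3 : C * C :=
  (det2 z1 z2 * z3.1 + lam * det2 z2 z3 * z1.1,
   det2 z1 z2 * z3.2 + lam * det2 z2 z3 * z1.2).

Lemma fourth_neq0 lam z1 z2 z3 : det2 z1 z2 != 0 -> det2 z1 z3 != 0 ->
  fourth lam z2 z1 z3 != (0, 0).
Proof.
move=> h12 h13; apply/eqP => h.
(* Pairing with [z1] removes the term containing [lam], so no value of [lam] is exceptional. *)
have : det2 z1 (fourth lam z2 z1 z3) = det2 z1 z2 * det2 z1 z3.
  by rewrite /fourth /det2 /=; ring.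
rewrite h /det2 /= !mulr0 subrr => /esym/eqP.
by rewrite mulf_eq0 (negPf h12) (negPf h13).
Qed.

Lemma fourth_uniq lam z1 z2 z3 z4 :
  det2 z1 z2 != 0 -> det2 z1 z3 != 0 -> z4 != (0, 0) ->
  peq1 (cr z1 z2 z3 z4) (lam, 1) ->
  exists2 k, k != 0 & let w := fourth lam z2 z1 z3 in z4 = (k * w.1, k * w.2).
Proof.
move=> h12 h13 z40 [_ [_]] /=; rewrite mulr1 => h.
have w0 := fourth_neq0 lam h12 h13.
have : det2 z4 (fourth lam z2 z1 z3) = 0.
  transitivity (det2 z2 z3 * det2 z4 z1 * lam - det2 z1 z2 * det2 z3 z4).
    by rewrite /fourth /det2 /=; ring.
  by rewrite h subrr.
case/(det2_eq0 w0) => k hk; exists k => //.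
by apply: contraNneq z40 => k0; rewrite hk k0 !mul0r.
Qed.

End Pairs.

Section CrLine.
Context {C : numClosedFieldType} {n : nat}.
Implicit Types (a b : 'cV[C]_n).

Lemma indep2_inj a b (x y : C * C) : indep2 a b ->
  x.1 *: a + x.2 *: b = y.1 *: a + y.2 *: b -> x = y.
Proof.
move=> ab h; have [] := ab (x.1 - y.1) (x.2 - y.2).
  by rewrite !scalerBl addrACA -opprD h subrr.
move/subr0_eq=> h1 /subr0_eq h2.
by rewrite (surjective_pairing x) h1 h2 -surjective_pairing.
Qed.

(** Cramer's rule. *)
Lemma in_span_basis2 s a b (w w' : C * C) : det2 w w' != 0 ->
  in_span s (w.1 *: a + w.2 *: b) -> in_span s (w'.1 *: a + w'.2 *: b) ->
  in_span s a /\ in_span s b.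
Proof.
move=> d h h'.
have ha : det2 w w' *: a = w'.2 *: (w.1 *: a + w.2 *: b)
                        + (- w.2) *: (w'.1 *: a + w'.2 *: b).
  by apply/colP => i; rewrite !mxE /det2; ring.
have hb : det2 w w' *: b = (- w'.1) *: (w.1 *: a + w.2 *: b)
                        + w.1 *: (w'.1 *: a + w'.2 *: b).
  by apply/colP => i; rewrite !mxE /det2; ring.
split; [rewrite -[a]scale1r|rewrite -[b]scale1r]; rewrite -(mulVf d) -scalerA.
  by rewrite ha; apply/in_spanZ/in_spanD; apply: in_spanZ.
by rewrite hb; apply/in_spanZ/in_spanD; apply: in_spanZ.
Qed.

(** The existentially chosen basis [a'], [b'] spans the same line as [a], [b], and a change of basis
    multiplies every [det2] by one determinant, which cancels in the cross-ratio. *)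
Lemma crLine_comb a b (z1 z2 z3 z4 c : C * C) : indep2 a b ->
  crLine (z1.1 *: a + z1.2 *: b) (z2.1 *: a + z2.2 *: b)
         (z3.1 *: a + z3.2 *: b) (z4.1 *: a + z4.2 *: b) c <->
  peq1 (cr z1 z2 z3 z4) c.
Proof.
move=> ab; split; last by move=> h; exists a, b; split=> //; exists z1, z2, z3, z4.
case=> [a' [b' [ab' [w1 [w2 [w3 [w4 [h1 h2 h3 h4 hc]]]]]]]].
have inab (z : C * C) : in_span [:: a; b] (z.1 *: a + z.2 *: b).
  by apply/in_span2; exists z.1, z.2.
(* A legitimate cross-ratio is not [(0, 0)], so the points 1, 2 or the points 2, 3 are distinct and
   recover the basis. *)
have [ha hb] : in_span [:: a; b] a' /\ in_span [:: a; b] b'.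
  have [/eqP d12 | d12] := boolP (det2 w1 w2 == 0); last first.
    by apply: (in_span_basis2 d12); rewrite -?h1 -?h2.
  have [/eqP d23 | d23] := boolP (det2 w2 w3 == 0); last first.
    by apply: (in_span_basis2 d23); rewrite -?h3 -?h2.
  by case: hc => /eqP[]; rewrite /cr d12 d23 !mul0r.
move: ha hb => /in_span2[A1 [A2 ea]] /in_span2[B1 [B2 eb]].
have hz (z w : C * C) : z.1 *: a + z.2 *: b = w.1 *: a' + w.2 *: b' ->
    z = (w.1 * A1 + w.2 * B1, w.1 * A2 + w.2 * B2).
  move=> e; apply: (indep2_inj ab); rewrite e ea eb.
  by apply/colP => i; rewrite !mxE /=; ring.
rewrite (hz _ _ h1) (hz _ _ h2) (hz _ _ h3) (hz _ _ h4).
have D0 : det2 (A1, A2) (B1, B2) != 0.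
  apply/eqP => D0.
  have l1 : B2 *: a' + (- A2) *: b' = 0.
    rewrite ea eb; transitivity (det2 (A1, A2) (B1, B2) *: a).
      by apply/colP => i; rewrite !mxE /det2 /=; ring.
    by rewrite D0 scale0r.
  have l2 : (- B1) *: a' + A1 *: b' = 0.
    rewrite ea eb; transitivity (det2 (A1, A2) (B1, B2) *: b).
      by apply/colP => i; rewrite !mxE /det2 /=; ring.
    by rewrite D0 scale0r.
  have [_ A20] := ab' _ _ l1; have [_ A10] := ab' _ _ l2.
  have /eqP := oner_neq0 C; apply.
  have [] // := ab' 1 0; move: A20 => /eqP; rewrite oppr_eq0 => /eqP A20.
  by rewrite ea A20 A10 !scale0r !addr0 scaler0.
apply/(@peq1_cr_transfer _ _ _ _ _ w1 w2 w3 w4 1 1 1 1 _ c _ _ _ _ D0);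
  rewrite ?oner_neq0 // /det2 /=; ring.
Qed.

End CrLine.

(** * Irreducible plane sections *)

Section Conic.
Context {C : numClosedFieldType}.
Implicit Types (a b c d o v : 'cV[C]_6) (s : seq 'cV[C]_6).

(** The Gram matrix has zero diagonal and determinant twice the product of the three pairings, so
    such vectors are a basis of a plane on which the form is nondegenerate. *)
Definition conic_frame a b c :=
  [/\ pform a a = 0, pform b b = 0 & pform c c = 0] /\
  [/\ pform a b != 0, pform a c != 0 & pform b c != 0].

Lemma irredConic_frame a b c :
  irredConic [:: a; b; c] -> pform a a = 0 -> pform b b = 0 -> pform c c = 0 ->
  conic_frame a b c.
Proof.
move=> irr aa bb cc; split; first by [].
split; first exact: irredConic_pform_neq0 irr aa bb cc.
  apply: (@irredConic_pform_neq0 _ a c b) => //; apply: irredConic_sub irr => x.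
  by rewrite !inE => /or3P[] /eqP->; apply: in_span_mem; rewrite !inE eqxx ?orbT.
apply: (@irredConic_pform_neq0 _ b c a) => //; apply: irredConic_sub irr => x.
by rewrite !inE => /or3P[] /eqP->; apply: in_span_mem; rewrite !inE eqxx ?orbT.
Qed.

(** Pairing with [a], [b], [c] gives a linear system whose matrix is the Gram matrix; the three
    combinations in the proof are, up to a factor, the rows of its adjugate. *)
Lemma conic_frame_uniq a b c (x y z x' y' z' : C) : conic_frame a b c ->
  x *: a + y *: b + z *: c = x' *: a + y' *: b + z' *: c ->
  [/\ x = x', y = y' & z = z'].
Proof.
case=> -[aa bb cc] [ab ac bc] h.
have E v : pform (x *: a + y *: b + z *: c) v
         = pform (x' *: a + y' *: b + z' *: c) v by rewrite h.
move: (E a) (E b) (E c); rewrite !(pformDl, pformZl) aa bb cc.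
rewrite (pformC b a) (pformC c a) (pformC c b) !mulr0 !addr0 !add0r => Ea Eb Ec.
set p := pform a b in ab Ea Eb Ec; set q := pform a c in ac Ea Eb Ec.
set r := pform b c in bc Ea Eb Ec.
have two0 : (2 : C) != 0 by rewrite pnatr_eq0.
have key (k u : C) : k != 0 -> k * u = 0 -> u = 0.
  by move=> k0 /eqP; rewrite mulf_eq0 (negPf k0) => /eqP.
split; apply/subr0_eq.
- apply: (key (2 * p * q)); first by rewrite !mulf_neq0.
  transitivity (q * (x * p + z * r - (x' * p + z' * r))
    + p * (x * q + y * r - (x' * q + y' * r))
    - r * (y * p + z * q - (y' * p + z' * q))); first by ring.
  by rewrite Ea Eb Ec !subrr; ring.
- apply: (key (2 * p * r)); first by rewrite !mulf_neq0.
  transitivity (r * (y * p + z * q - (y' * p + z' * q))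
    + p * (x * q + y * r - (x' * q + y' * r))
    - q * (x * p + z * r - (x' * p + z' * r))); first by ring.
  by rewrite Ea Eb Ec !subrr; ring.
apply: (key (2 * q * r)); first by rewrite !mulf_neq0.
transitivity (q * (x * p + z * r - (x' * p + z' * r))
  + r * (y * p + z * q - (y' * p + z' * q))
  - p * (x * q + y * r - (x' * q + y' * r))); first by ring.
by rewrite Ea Eb Ec !subrr; ring.
Qed.

Lemma pform_frame a b c (x y z x' y' z' : C) : conic_frame a b c ->
  pform (x *: a + y *: b + z *: c) (x' *: a + y' *: b + z' *: c) =
  pform a b * (x * y' + x' * y) + pform a c * (x * z' + x' * z)
  + pform b c * (y * z' + y' * z).
Proof.
case=> -[aa bb cc] _.
rewrite !(pformDl, pformDr, pformZl, pformZr) aa bb cc.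
by rewrite (pformC b a) (pformC c a) (pformC c b); ring.
Qed.

Lemma mulf_eq0_r (k u : C) : k != 0 -> k * u = 0 -> u = 0.
Proof. by move=> k0 /eqP; rewrite mulf_eq0 (negPf k0) => /eqP. Qed.

(* If [(x, y, z)] and [(x', y', z')] are isotropic and orthogonal then so is
   every combination; the one whose first coordinate vanishes gives
   [(x y' - x' y) (x z' - x' z) = 0]. *)
Lemma isotropic_minor_step (p q r x y z x' y' z' : C) : r != 0 ->
  p * (x * y) + q * (x * z) + r * (y * z) = 0 ->
  p * (x' * y') + q * (x' * z') + r * (y' * z') = 0 ->
  p * (x * y' + x' * y) + q * (x * z' + x' * z) + r * (y * z' + y' * z) = 0 ->
  x * y' = x' * y \/ x * z' = x' * z.
Proof.
move=> r0 h1 h2 h3; suff /eqP : (x * y' - x' * y) * (x * z' - x' * z) = 0.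
  by rewrite mulf_eq0 => /orP[] /eqP/subr0_eq; [left | right].
apply: (mulf_eq0_r r0); transitivity
  (x ^+ 2 * (p * (x' * y') + q * (x' * z') + r * (y' * z'))
   + x' ^+ 2 * (p * (x * y) + q * (x * z) + r * (y * z))
   - x * x' * (p * (x * y' + x' * y) + q * (x * z' + x' * z)
               + r * (y * z' + y' * z))); first by ring.
by rewrite h1 h2 h3; ring.
Qed.

(** If [x] or [x'] is nonzero, the third minor follows from the other two. If both vanish, isotropy
    leaves only multiples of the last two frame vectors, and these are not orthogonal because
    [r != 0]. *)
Lemma isotropic_minor_last (p q r x y z x' y' z' : C) :
  p != 0 -> q != 0 -> r != 0 ->
  p * (x * y) + q * (x * z) + r * (y * z) = 0 ->
  p * (x' * y') + q * (x' * z') + r * (y' * z') = 0 ->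
  p * (x * y' + x' * y) + q * (x * z' + x' * z) + r * (y * z' + y' * z) = 0 ->
  x * y' = x' * y -> x * z' = x' * z -> y * z' = y' * z.
Proof.
move=> p0 q0 r0 h1 h2 h3 m12 m13.
have [x0 | x0] := eqVneq x 0; last first.
  apply: (mulfI x0); transitivity (y * (x * z')); first by ring.
  rewrite m13; transitivity (x' * y * z); first by ring.
  by rewrite -m12; ring.
have [x0' | x0'] := eqVneq x' 0; last first.
  apply: (mulfI x0'); transitivity (x' * y * z'); first by ring.
  rewrite -m12; transitivity (y' * (x * z')); first by ring.
  by rewrite m13; ring.
move: h1 h2 h3; rewrite x0 x0' !mul0r !addr0 !mulr0 !add0r => h1 h2 h3.
have {h1}/eqP := mulf_eq0_r r0 h1; have {h2}/eqP := mulf_eq0_r r0 h2.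
have {}h3 := mulf_eq0_r r0 h3.
rewrite !mulf_eq0 => /orP[] /eqP e /orP[] /eqP e'; move: h3; rewrite e e';
  by rewrite !(mul0r, mulr0, addr0, add0r) // => ->.
Qed.

(** Applied to each coordinate in turn, [isotropic_minor_step] finds a zero in every pair of minors.
    So at least two of them vanish, and [isotropic_minor_last] gives the remaining one. *)
Lemma orthogonal_isotropic_minors (p q r x y z x' y' z' : C) :
  p != 0 -> q != 0 -> r != 0 ->
  p * (x * y) + q * (x * z) + r * (y * z) = 0 ->
  p * (x' * y') + q * (x' * z') + r * (y' * z') = 0 ->
  p * (x * y' + x' * y) + q * (x * z' + x' * z) + r * (y * z' + y' * z) = 0 ->
  [/\ x * y' = x' * y, x * z' = x' * z & y * z' = y' * z].
Proof.
move=> p0 q0 r0 h1 h2 h3.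
have h1a : p * (y * x) + r * (y * z) + q * (x * z) = 0 by rewrite -h1; ring.
have h2a : p * (y' * x') + r * (y' * z') + q * (x' * z') = 0 by rewrite -h2; ring.
have h3a : p * (y * x' + y' * x) + r * (y * z' + y' * z)
         + q * (x * z' + x' * z) = 0 by rewrite -h3; ring.
have h1b : q * (z * x) + r * (z * y) + p * (x * y) = 0 by rewrite -h1; ring.
have h2b : q * (z' * x') + r * (z' * y') + p * (x' * y') = 0 by rewrite -h2; ring.
have h3b : q * (z * x' + z' * x) + r * (z * y' + z' * y)
         + p * (x * y' + x' * y) = 0 by rewrite -h3; ring.
have M1 := isotropic_minor_last p0 q0 r0 h1 h2 h3.
have M2 := isotropic_minor_last p0 r0 q0 h1a h2a h3a.
have M3 := isotropic_minor_last q0 r0 p0 h1b h2b h3b.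
case: (isotropic_minor_step r0 h1 h2 h3) => e1;
  case: (isotropic_minor_step q0 h1a h2a h3a) => e2;
  case: (isotropic_minor_step p0 h1b h2b h3b) => e3.
- have e : x * z' = x' * z by rewrite mulrC -e3 mulrC.
  by split=> //; exact: M1.
- have e : y * z' = y' * z by rewrite mulrC -e3 mulrC.
  by split=> //; apply: M2 => //; rewrite mulrC -e1 mulrC.
- have e : x * z' = x' * z by rewrite mulrC -e3 mulrC.
  by split=> //.
- by split=> //; apply: M2 => //; rewrite mulrC -e1 mulrC.
- have e : x * y' = x' * y by rewrite mulrC -e2 mulrC.
  by split=> //; exact: M1.
- have e : y * z' = y' * z by rewrite mulrC -e3 mulrC.
  have e' : x * y' = x' * y by rewrite mulrC -e2 mulrC.
  by split.
- have e : x * y' = x' * y.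
    by apply: M3; rewrite // mulrC -?e1 -?e2 mulrC.
  by split.
have e : x * y' = x' * y.
  by apply: M3; rewrite // mulrC -?e1 -?e2 mulrC.
by split.
Qed.

(** Independent orthogonal isotropic vectors would span a line contained in the conic. *)
Lemma frame_isotropic_orth a b c o v : conic_frame a b c ->
  in_span [:: a; b; c] o -> in_span [:: a; b; c] v -> v != 0 ->
  pform o o = 0 -> pform v v = 0 -> pform o v = 0 -> in_span [:: v] o.
Proof.
move=> F /in_span3[x [y [z ->]]] /in_span3[x' [y' [z' ->]]] v0.
have [_ [ab ac bc]] := F.
rewrite !(pform_frame _ _ _ _ _ _ F) => h1 h2 h3; apply/in_span1.
have half (t p q r X Y Z : C) : t = 0 ->
    2 * (p * X + q * Y + r * Z) = t -> p * X + q * Y + r * Z = 0.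
  move=> -> /eqP; rewrite mulf_eq0 pnatr_eq0 /= => /eqP //.
have {}h1 := half _ (pform a b) (pform a c) (pform b c) (x * y) (x * z) (y * z) h1.
have {}h2 := half _ (pform a b) (pform a c) (pform b c) (x' * y') (x' * z') (y' * z') h2.
have [m1 m2 m3] := orthogonal_isotropic_minors ab ac bc
  (h1 ltac:(ring)) (h2 ltac:(ring)) h3.
have E (u u' w w' : C) : w' != 0 -> w * u' = w' * u -> w / w' * u' = u.
  by move=> w0 e; rewrite mulrAC e [w' * u]mulrC mulfK.
have [x0 | x0] := eqVneq x' 0; last first.
  by exists (x / x'); rewrite !scalerDr !scalerA mulfVK // (E y) // (E z).
have [y0 | y0] := eqVneq y' 0; last first.
  exists (y / y'); rewrite !scalerDr !scalerA mulfVK // (E x) ?(E z) //.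
  by rewrite [LHS]mulrC -m1 mulrC.
have [z0 | z0] := eqVneq z' 0; last first.
  exists (z / z'); rewrite !scalerDr !scalerA mulfVK // (E x) ?(E y) //.
    by rewrite [LHS]mulrC -m3 mulrC.
  by rewrite [LHS]mulrC -m2 mulrC.
by move: v0; rewrite x0 y0 z0 !scale0r !addr0 eqxx.
Qed.

Lemma coplanar4P a b c d :
  coplanar [:: a; b; c; d] <-> exists x y z t : C,
    [|| x != 0, y != 0, z != 0 | t != 0] /\
    x *: a + y *: b + z *: c + t *: d = 0.
Proof.
split.
  case=> cs [sz []]; case: cs sz => [|x [|y [|z [|t []]]]] // _.
  rewrite !big_ord_recl big_ord0 /= orbF addr0 !addrA => h e.
  by exists x, y, z, t.
case=> x [y [z [t [h e]]]]; exists [:: x; y; z; t]; split=> //=.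
by rewrite !big_ord_recl big_ord0 /= orbF addr0 !addrA.
Qed.

(** A vertex with nonzero coefficient in the linear relation lies in the span of the other three, so
    these still span an irreducible section. The omitted vertex [d] is kept because a centre of
    projection has to avoid it as well. *)
Lemma conic_frame_exists s : size s = 4%N -> coplanar s -> irredConic s ->
  (forall x, x \in s -> pform x x = 0) ->
  exists a b c, [/\ conic_frame a b c, {subset [:: a; b; c] <= s},
    (forall x, x \in s -> in_span [:: a; b; c] x) &
    exists d, {subset s <= [:: a; b; c; d]}].
Proof.
case: s => [|x1 [|x2 [|x3 [|x4 []]]]] // _ /coplanar4P[k1 [k2 [k3 [k4 [k0 e]]]]].
move=> irr iso.
have aux a b c d (p q r t : C) : t != 0 -> {subset [:: a; b; c] <= [:: x1; x2; x3; x4]} ->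
    p *: a + q *: b + r *: c + t *: d = 0 ->
    {subset [:: x1; x2; x3; x4] <= [:: a; b; c; d]} ->
    exists a b c, [/\ conic_frame a b c, {subset [:: a; b; c] <= [:: x1; x2; x3; x4]},
    (forall x, x \in [:: x1; x2; x3; x4] -> in_span [:: a; b; c] x) &
    exists d, {subset [:: x1; x2; x3; x4] <= [:: a; b; c; d]}].
  move=> t0 s1 h s2; exists a, b, c.
  have din : in_span [:: a; b; c] d.
    apply/in_span3; exists (- (p / t)), (- (q / t)), (- (r / t)).
    have -> : d = t^-1 *: (p *: a + q *: b + r *: c + t *: d)
                + (- (p / t) *: a + - (q / t) *: b + - (r / t) *: c).
      by apply/colP => i; rewrite !mxE; field.
    by rewrite {1}h scaler0 add0r.
  have sp x : x \in [:: x1; x2; x3; x4] -> in_span [:: a; b; c] x.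
    move/s2; rewrite !inE => /or4P[] /eqP->; last exact: din;
      by apply: in_span_mem; rewrite !inE eqxx ?orbT.
  split=> //; last by exists d.
  apply: irredConic_frame; first exact: irredConic_sub irr.
  - by apply: iso; apply: s1; rewrite !inE eqxx.
  - by apply: iso; apply: s1; rewrite !inE eqxx orbT.
  by apply: iso; apply: s1; rewrite !inE eqxx !orbT.
case/or4P: k0 => k0.
- apply: (@aux x2 x3 x4 x1 k2 k3 k4 k1) => // [x||x].
  + by rewrite !inE => /or3P[] /eqP->; rewrite eqxx ?orbT.
  + by rewrite -e; apply/colP => i; rewrite !mxE; ring.
  by rewrite !inE => /or4P[] /eqP->; rewrite eqxx ?orbT.
- apply: (@aux x1 x3 x4 x2 k1 k3 k4 k2) => // [x||x].
  + by rewrite !inE => /or3P[] /eqP->; rewrite eqxx ?orbT.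
  + by rewrite -e; apply/colP => i; rewrite !mxE; ring.
  by rewrite !inE => /or4P[] /eqP->; rewrite eqxx ?orbT.
- apply: (@aux x1 x2 x4 x3 k1 k2 k4 k3) => // [x||x].
  + by rewrite !inE => /or3P[] /eqP->; rewrite eqxx ?orbT.
  + by rewrite -e; apply/colP => i; rewrite !mxE; ring.
  by rewrite !inE => /or4P[] /eqP->; rewrite eqxx ?orbT.
apply: (@aux x1 x2 x3 x4 k1 k2 k3 k4) => // [x].
by rewrite !inE => /or3P[] /eqP->; rewrite eqxx ?orbT.
Qed.

(* [r v w *: a + q u w *: b + p u v *: c] with [u + v + w = 0] parametrises the
   conic; the points with [(u, v, w) = (1, 1, -2)] and [(1, 2, -3)] lie off the
   frame and are distinct, so one of them is not [d]. *)
Lemma conic_frame_point a b c d : conic_frame a b c -> exists x y z : C,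
  let o := x *: a + y *: b + z *: c in
  [/\ z != 0, pform o o = 0 &
      forall v, v \in [:: a; b; c; d] -> ~ in_span [:: v] o].
Proof.
move=> F; have [_ [p0 q0 r0]] := F.
set p := pform a b in p0; set q := pform a c in q0; set r := pform b c in r0.
have n0 k : (k.+1%:R : C) != 0 by rewrite pnatr_eq0.
pose o1 := (- 2 * r) *: a + (- 2 * q) *: b + p *: c.
pose o2 := (- 6 * r) *: a + (- 3 * q) *: b + (2 * p) *: c.
have iso1 : pform o1 o1 = 0 by rewrite pform_frame // -/p -/q -/r; ring.
have iso2 : pform o2 o2 = 0 by rewrite pform_frame // -/p -/q -/r; ring.
have N (x y z : C) v : x != 0 -> y != 0 -> z != 0 -> v \in [:: a; b; c] ->
    ~ in_span [:: v] (x *: a + y *: b + z *: c).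
  move=> x0 y0 z0; rewrite !inE => /or3P[] /eqP-> /in_span1[k].
  - have -> : k *: a = k *: a + 0 *: b + 0 *: c by rewrite !scale0r !addr0.
    by move=> e; have [_ /eqP] := conic_frame_uniq F e; rewrite (negPf y0).
  - have -> : k *: b = 0 *: a + k *: b + 0 *: c.
      by rewrite !scale0r addr0 add0r.
    by move=> e; have [/eqP] := conic_frame_uniq F e; rewrite (negPf x0).
  have -> : k *: c = 0 *: a + 0 *: b + k *: c by rewrite !scale0r !add0r.
  by move=> e; have [/eqP] := conic_frame_uniq F e; rewrite (negPf x0).
have cr0 k (u : C) : u != 0 -> - k.+1%:R * u != 0
  by move=> u0; rewrite mulf_neq0 ?oppr_eq0.
have pr0 k (u : C) : u != 0 -> k.+1%:R * u != 0 by move=> u0; rewrite mulf_neq0.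
have [d1 | d1] := eqVneq (pform o1 d) 0.
  exists (- 6 * r), (- 3 * q), (2 * p); split=> //; first exact: pr0.
  move=> v; rewrite -[_ :: _]/([:: a; b; c] ++ [:: d]) mem_cat => /orP[m | ].
    by apply: N => //; [exact: cr0 | exact: cr0 | exact: pr0].
  rewrite inE => /eqP-> /in_span1[k hk].
  have /eqP : pform o1 o2 = 0 by rewrite /o2 hk pformZr d1 mulr0.
  suff -> : pform o1 o2 = p * q * r by rewrite !mulf_eq0 (negPf p0) (negPf q0) (negPf r0).
  by rewrite pform_frame // -/p -/q -/r; ring.
exists (- 2 * r), (- 2 * q), p; split=> // v.
rewrite -[_ :: _]/([:: a; b; c] ++ [:: d]) mem_cat => /orP[m | ].
  by apply: N => //; exact: cr0.
rewrite inE => /eqP-> /in_span1[k hk]; case/eqP: d1.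
have [k0 | k0] := eqVneq k 0; first by rewrite /o1 hk k0 scale0r pform0l.
apply: (mulfI k0); rewrite mulr0 -pformZr -hk; exact: iso1.
Qed.

End Conic.

(** * The Segre parametrisation and the Steiner cross-ratio *)

(** [P] and [Q] are the images of a basis under a linear map to [C * C], with [m] and [m'] the scale
    factors of the image points; this is the shape of the hypotheses of [peq1_cr_transfer]. *)
Lemma det2_comb {C : numClosedFieldType} (P Q : C * C) m m' x x' z z' :
  (m * x.1, m * x.2) = (z.1 * P.1 + z.2 * Q.1, z.1 * P.2 + z.2 * Q.2) ->
  (m' * x'.1, m' * x'.2) = (z'.1 * P.1 + z'.2 * Q.1, z'.1 * P.2 + z'.2 * Q.2) ->
  m * m' * det2 x x' = det2 P Q * det2 z z'.
Proof.
move=> [h h'] [k k'].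
transitivity ((m * x.1) * (m' * x'.2) - (m * x.2) * (m' * x'.1)).
  by rewrite /det2; ring.
by rewrite h h' k k' /det2; ring.
Qed.

Section Segre.
Context {C : numClosedFieldType}.
Implicit Types (x y z w c : C * C) (o v : 'cV[C]_6).

Definition segre (g11 g12 g21 g22 : 'cV[C]_6) x y : 'cV[C]_6 :=
  (x.1 * y.1) *: g11 + (x.1 * y.2) *: g12
  + (x.2 * y.1) *: g21 + (x.2 * y.2) *: g22.

Lemma segre_swap g11 g12 g21 g22 x y :
  segre g11 g21 g12 g22 y x = segre g11 g12 g21 g22 x y.
Proof. by apply/colP => i; rewrite !mxE; ring. Qed.

(** Kept abstract so that statements about the first factor pass to the second by exchanging [g12]
    and [g21]. *)
Definition segre_form g11 g12 g21 g22 (kap : C) :=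
  kap != 0 /\ forall x y x' y',
    pform (segre g11 g12 g21 g22 x y) (segre g11 g12 g21 g22 x' y') =
    kap * det2 x x' * det2 y y'.

Lemma segre_form_swap g11 g12 g21 g22 kap :
  segre_form g11 g12 g21 g22 kap -> segre_form g11 g21 g12 g22 kap.
Proof.
move=> [k0 H]; split=> // x y x' y'.
by rewrite 2!(segre_swap g11 g12 g21) H mulrAC.
Qed.

Section Form.
Context {g11 g12 g21 g22 : 'cV[C]_6} {kap : C}.
Hypothesis H : segre_form g11 g12 g21 g22 kap.
Local Notation sg := (segre g11 g12 g21 g22).

Let kap0 : kap != 0. Proof. by case: H. Qed.
Let HE x y x' y' : pform (sg x y) (sg x' y') = kap * det2 x x' * det2 y y'.
Proof. by case: H. Qed.

Lemma segre_isotropic x y : pform (sg x y) (sg x y) = 0.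
Proof. by rewrite HE det2xx mulr0 mul0r. Qed.

Lemma pform_segre_neq0 x y x' y' :
  (pform (sg x y) (sg x' y') != 0) = (det2 x x' != 0) && (det2 y y' != 0).
Proof. by rewrite HE !mulf_eq0 (negPf kap0) negb_or. Qed.

Lemma segreZ s t x y : sg (s * x.1, s * x.2) (t * y.1, t * y.2) = (s * t) *: sg x y.
Proof. by apply/colP => i; rewrite !mxE /=; ring. Qed.

Lemma segre_neq0 x y : (sg x y != 0) = (x != (0, 0)) && (y != (0, 0)).
Proof.
have [->|x0] := eqVneq x (0, 0).
  by rewrite /segre /= !mul0r !scale0r !addr0 eqxx.
have [->|y0] := eqVneq y (0, 0).
  by rewrite /segre /= !mulr0 !scale0r !addr0 eqxx.
have [x' hx] := det2_ndeg x0; have [y' hy] := det2_ndeg y0.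
have := pform_segre_neq0 x y x' y'; rewrite hx hy.
by apply: contraTneq => ->; rewrite pform0l eqxx.
Qed.

(** Any vector [sg x' w] is orthogonal to the right-hand point, hence to the left-hand one; a [w]
    with [det2 y w != 0] then forces [det2 x x' = 0]. *)
Lemma segre_peq x y x' y' : peq (sg x y) (sg x' y') ->
  det2 x x' = 0 /\ det2 y y' = 0.
Proof.
move=> [h1 [_ [t ht]]].
move: h1; rewrite segre_neq0 => /andP[x0 y0].
have [v hv] := det2_ndeg x0; have [w hw] := det2_ndeg y0.
split; apply/eqP; rewrite -[_ == 0]negbK; apply/negP => h.
  have := pform_segre_neq0 x y x' w; rewrite h hw /= ht pformZl HE.
  by rewrite det2xx mulr0 mul0r mulr0 eqxx.
have := pform_segre_neq0 x y v y'; rewrite h hv /= ht pformZl HE.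
by rewrite det2xx !mulr0 eqxx.
Qed.

(** The quadratic form is [2 * kap] times the determinant of the 2 by 2 coefficient matrix, so
    isotropic means rank at most one. The witnesses factor the matrix according to the first nonzero
    entry of its first column. *)
Lemma isotropic_segre o : in_span [:: g11; g12; g21; g22] o ->
  pform o o = 0 -> exists x y, o = sg x y.
Proof.
move=> /in_span_cons[a [v [/in_span3[b [c [d ->]]] ->]]].
have h11 : g11 = sg (1, 0) (1, 0) by apply/colP => i; rewrite !mxE /=; ring.
have h12 : g12 = sg (1, 0) (0, 1) by apply/colP => i; rewrite !mxE /=; ring.
have h21 : g21 = sg (0, 1) (1, 0) by apply/colP => i; rewrite !mxE /=; ring.
have h22 : g22 = sg (0, 1) (0, 1) by apply/colP => i; rewrite !mxE /=; ring.
have -> : pform (a *: g11 + (b *: g12 + c *: g21 + d *: g22))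
    (a *: g11 + (b *: g12 + c *: g21 + d *: g22)) = 2 * kap * (a * d - b * c).
  have G x y x' y' u u' : u = sg x y -> u' = sg x' y' ->
    pform u u' = kap * det2 x x' * det2 y y' by move=> -> ->.
  rewrite !(pformDl, pformDr, pformZl, pformZr).
  rewrite (G _ _ _ _ _ _ h11 h11) (G _ _ _ _ _ _ h11 h12)
    (G _ _ _ _ _ _ h11 h21) (G _ _ _ _ _ _ h11 h22).
  rewrite (G _ _ _ _ _ _ h12 h11) (G _ _ _ _ _ _ h12 h12)
    (G _ _ _ _ _ _ h12 h21) (G _ _ _ _ _ _ h12 h22).
  rewrite (G _ _ _ _ _ _ h21 h11) (G _ _ _ _ _ _ h21 h12)
    (G _ _ _ _ _ _ h21 h21) (G _ _ _ _ _ _ h21 h22).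
  rewrite (G _ _ _ _ _ _ h22 h11) (G _ _ _ _ _ _ h22 h12)
    (G _ _ _ _ _ _ h22 h21) (G _ _ _ _ _ _ h22 h22).
  by rewrite /det2 /=; ring.
move/mulf_eq0_r; rewrite mulf_neq0 ?pnatr_eq0 // => /(_ isT)/subr0_eq e.
have [a0 | a0] := eqVneq a 0; last first.
  exists (a, c), (1, b / a); apply/colP => i; rewrite !mxE /=.
  have -> : d = b * c / a by rewrite -e [a * d]mulrC mulfK.
  by field.
have [c0 | c0] := eqVneq c 0; last first.
  have b0 : b = 0.
    by apply: (mulIf c0); rewrite -e a0 !mul0r.
  by exists (0, 1), (c, d); apply/colP => i; rewrite !mxE /= a0 b0; ring.
by exists (b, d), (0, 1); apply/colP => i; rewrite !mxE /= a0 c0; ring.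
Qed.

(* Contraction of the second factor with [y0], up to the factor [kap]. *)
Let L y0 v : C * C := (pform v (sg (0, 1) y0), - pform v (sg (1, 0) y0)).

Let L_comb y0 (s t : C) v v' : L y0 (s *: v + t *: v') =
  (s * (L y0 v).1 + t * (L y0 v').1, s * (L y0 v).2 + t * (L y0 v').2).
Proof. by rewrite /L !(pformDl, pformZl) /=; congr pair; ring. Qed.

Let L_segre y0 x y : L y0 (sg x y) = (kap * det2 y y0 * x.1, kap * det2 y y0 * x.2).
Proof. by rewrite /L !HE /det2 /=; congr pair; ring. Qed.

Section Face.
Context {x1 x2 x3 x4 y1 y2 y3 y4 : C * C}.
Let s := [:: sg x1 y1; sg x2 y2; sg x3 y3; sg x4 y4].
Hypotheses (s0 : 0 \notin s) (cop : coplanar s) (irr : irredConic s).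

Let s_segre v : v \in s -> exists x y, v = sg x y.
Proof.
by rewrite !inE => /or4P[] /eqP->;
  [exists x1, y1 | exists x2, y2 | exists x3, y3 | exists x4, y4].
Qed.

Let s_isotropic v : v \in s -> pform v v = 0.
Proof. by move/s_segre => [x [y ->]]; exact: segre_isotropic. Qed.

Let s_span v : in_span s v -> in_span [:: g11; g12; g21; g22] v.
Proof.
apply: in_span_sub => _ /s_segre[x [y ->]].
by do !apply: in_spanD; apply/in_spanZ/in_span_mem; rewrite !inE eqxx ?orbT.
Qed.

(** A vertex sharing its second factor with the centre [o] would be orthogonal to it, hence equal to
    it as a point of the conic. So contraction with [y0] kills no vertex. *)
Let off_conic o x y x0 y0 : in_span s o -> pform o o = 0 -> o = sg x0 y0 ->
  sg x y \in s -> ~ in_span [:: sg x y] o -> kap * det2 y y0 != 0.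
Proof.
move=> so oo eo sxy; apply: contra_notN; rewrite mulf_eq0 (negPf kap0) /= => /eqP d.
have [a [b [c [F _ sp _]]]] := @conic_frame_exists _ s erefl cop irr s_isotropic.
apply: (frame_isotropic_orth F) => //.
- by apply: in_span_sub so.
- exact: sp.
- by apply: contraNneq s0 => <-.
- exact: segre_isotropic.
by rewrite pformC eo HE d mulr0.
Qed.

Lemma steiner_segre c : steinerCR (sg x1 y1) (sg x2 y2) (sg x3 y3) (sg x4 y4) c ->
  peq1 (cr x1 x2 x3 x4) c.
Proof.
case=> o [a [b [o0 oo so no [_ _ _ nab [u1 [u2 [u3 [u4 [hu]]]]]]]]].
case=> [p [q [pq [z1 [z2 [z3 [z4 [e1 e2 e3 e4 hc]]]]]]]].
have [x0 [y0 eo]] := isotropic_segre (s_span so) oo.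
(* The contraction kills [o], so every other point of the line joining [o] to a vertex is sent to
   the first component of that vertex. *)
have proj u x y z :
    [/\ u != 0, in_span [:: a; b] u & in_span [:: o; sg x y] u] -> sg x y \in s ->
    u = z.1 *: p + z.2 *: q -> exists2 m, m != 0 &
    (m * x.1, m * x.2) = (z.1 * (L y0 p).1 + z.2 * (L y0 q).1,
                          z.1 * (L y0 p).2 + z.2 * (L y0 q).2).
  move=> [u0 uab /in_span2[al [be uo]]] sxy uz.
  have k0 := off_conic so oo eo sxy (no _ sxy).
  (* The projected point is not [o], since [o] lies off the line [a], [b]. *)
  have be0 : be != 0.
    apply/eqP => be0; apply: nab; move: uo u0; rewrite be0 scale0r addr0 => uo.
    rewrite uo scaler_eq0 negb_or => /andP[al0 _].
    by rewrite -[o]scale1r -(mulVf al0) -scalerA -uo; exact: in_spanZ.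
  exists (be * (kap * det2 y y0)); first by rewrite mulf_neq0.
  rewrite -L_comb -uz uo L_comb eo !L_segre det2xx mulr0 !mul0r !mulr0 !add0r /=.
  by rewrite !mulrA.
have s2 : sg x2 y2 \in s by rewrite !inE eqxx !orbT.
have s3 : sg x3 y3 \in s by rewrite !inE eqxx !orbT.
have s4 : sg x4 y4 \in s by rewrite !inE eqxx !orbT.
have [m1 n1 h1] := proj _ _ _ _
  (hu (u1, sg x1 y1) ltac:(by rewrite !inE eqxx)) (mem_head _ _) e1.
have [m2 n2 h2] := proj _ _ _ _
  (hu (u2, sg x2 y2) ltac:(by rewrite !inE eqxx !orbT)) s2 e2.
have [m3 n3 h3] := proj _ _ _ _
  (hu (u3, sg x3 y3) ltac:(by rewrite !inE eqxx !orbT)) s3 e3.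
have [m4 n4 h4] := proj _ _ _ _
  (hu (u4, sg x4 y4) ltac:(by rewrite !inE eqxx !orbT)) s4 e4.
move: (L y0 p) (L y0 q) h1 h2 h3 h4 => P Q h1 h2 h3 h4.
pose T := det2_comb (P := P) (Q := Q).
(* Otherwise all first components would coincide and all vertices would be mutually orthogonal,
   against the existence of a frame among them. *)
have D0 : det2 P Q != 0.
  apply/eqP => D.
  have Z x x' m m' z z' : m != 0 -> m' != 0 -> (m * x.1, m * x.2) =
      (z.1 * P.1 + z.2 * Q.1, z.1 * P.2 + z.2 * Q.2) ->
    (m' * x'.1, m' * x'.2) = (z'.1 * P.1 + z'.2 * Q.1, z'.1 * P.2 + z'.2 * Q.2) ->
    det2 x x' = 0.
    move=> m0 m0' h h'; apply: (@mulf_eq0_r _ (m * m')).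
      by rewrite mulf_neq0.
    by rewrite (T _ _ _ _ _ _ h h') D mul0r.
  have [a' [b' [c' [F sub _ _]]]] :=
  @conic_frame_exists _ s erefl cop irr s_isotropic.
  have [_ [/negP[]]] := F; apply/eqP.
  have : b' \in s by apply: sub; rewrite !inE eqxx orbT.
  have : a' \in s by apply: sub; rewrite !inE eqxx.
  have Y x x' y y' : det2 x x' = 0 -> pform (sg x y) (sg x' y') = 0.
    by move=> d; rewrite HE d mulr0 mul0r.
  rewrite !inE => /or4P[] /eqP-> /or4P[] /eqP->; apply: Y;
    [> exact: (Z _ _ _ _ _ _ n1 n1 h1 h1)
     | exact: (Z _ _ _ _ _ _ n1 n2 h1 h2)
     | exact: (Z _ _ _ _ _ _ n1 n3 h1 h3)
     | exact: (Z _ _ _ _ _ _ n1 n4 h1 h4)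
     | exact: (Z _ _ _ _ _ _ n2 n1 h2 h1)
     | exact: (Z _ _ _ _ _ _ n2 n2 h2 h2)
     | exact: (Z _ _ _ _ _ _ n2 n3 h2 h3)
     | exact: (Z _ _ _ _ _ _ n2 n4 h2 h4)
     | exact: (Z _ _ _ _ _ _ n3 n1 h3 h1)
     | exact: (Z _ _ _ _ _ _ n3 n2 h3 h2)
     | exact: (Z _ _ _ _ _ _ n3 n3 h3 h3)
     | exact: (Z _ _ _ _ _ _ n3 n4 h3 h4)
     | exact: (Z _ _ _ _ _ _ n4 n1 h4 h1)
     | exact: (Z _ _ _ _ _ _ n4 n2 h4 h2)
     | exact: (Z _ _ _ _ _ _ n4 n3 h4 h3)
     | exact: (Z _ _ _ _ _ _ n4 n4 h4 h4)].
by apply/(peq1_cr_transfer _ n1 n2 n3 n4 D0 (T _ _ _ _ _ _ h1 h2)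
  (T _ _ _ _ _ _ h3 h4) (T _ _ _ _ _ _ h2 h3) (T _ _ _ _ _ _ h4 h1)).
Qed.

(** If both entries vanish, one determinant from each product does; these two share an index, so
    three of the first components coincide. A frame among the vertices has three distinct first
    components, which is impossible. *)
Lemma segre_cr_neq0 : cr x1 x2 x3 x4 != (0, 0).
Proof.
have [z1 z2 z3 z4] : [/\ x1 != (0, 0), x2 != (0, 0), x3 != (0, 0) & x4 != (0, 0)].
  move: s0; rewrite !inE !negb_or ![0 == _]eq_sym !segre_neq0.
  by case/and4P => /andP[? _] /andP[? _] /andP[? _] /andP[? _].
have [a [b [c [[_ [ab ac bc]] sub _ _]]]] :=
  @conic_frame_exists _ s erefl cop irr s_isotropic.
have sa : a \in s by apply: sub; rewrite !inE eqxx.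
have sb : b \in s by apply: sub; rewrite !inE eqxx orbT.
have sc : c \in s by apply: sub; rewrite !inE eqxx !orbT.
have key x x' x'' : det2 x x' = 0 -> det2 x' x'' = 0 -> x' != (0, 0) ->
    [/\ det2 x x' = 0, det2 x' x = 0, det2 x' x'' = 0, det2 x'' x' = 0 &
     det2 x x'' = 0 /\ det2 x'' x = 0].
  move=> e1 e2 n; have e3 := det2_trans n e1 e2.
  by do !split=> //; rewrite det2C ?e1 ?e2 ?e3 oppr0.
apply/eqP => -[/eqP + /eqP]; rewrite !mulf_eq0.
move: ab ac bc sa sb sc => + + + + + + /orP[] /eqP d /orP[] /eqP d'.
- have [e1 e2 e3 e4 [e5 e6]] := key _ _ _ d d' z2.
  rewrite !inE => ab ac bc /or4P[] /eqP ea /or4P[] /eqP eb /or4P[] /eqP ec;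
    move: ab ac bc; rewrite ea eb ec !pform_segre_neq0 ?det2xx ?e1 ?e2 ?e3 ?e4
    ?e5 ?e6 ?eqxx //=.
- have [e1 e2 e3 e4 [e5 e6]] := key _ _ _ d' d z1.
  rewrite !inE => ab ac bc /or4P[] /eqP ea /or4P[] /eqP eb /or4P[] /eqP ec;
    move: ab ac bc; rewrite ea eb ec !pform_segre_neq0 ?det2xx ?e1 ?e2 ?e3 ?e4
    ?e5 ?e6 ?eqxx //=.
- have [e1 e2 e3 e4 [e5 e6]] := key _ _ _ d' d z3.
  rewrite !inE => ab ac bc /or4P[] /eqP ea /or4P[] /eqP eb /or4P[] /eqP ec;
    move: ab ac bc; rewrite ea eb ec !pform_segre_neq0 ?det2xx ?e1 ?e2 ?e3 ?e4
    ?e5 ?e6 ?eqxx //=.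
have [e1 e2 e3 e4 [e5 e6]] := key _ _ _ d d' z4.
rewrite !inE => ab ac bc /or4P[] /eqP ea /or4P[] /eqP eb /or4P[] /eqP ec;
  move: ab ac bc; rewrite ea eb ec !pform_segre_neq0 ?det2xx ?e1 ?e2 ?e3 ?e4
  ?e5 ?e6 ?eqxx //=.
Qed.

(** The centre comes from [conic_frame_point], and the target line joins the first two frame
    vectors; [Z != 0] says that the centre is off that line. *)
Lemma segre_steiner c : peq1 (cr x1 x2 x3 x4) c ->
  steinerCR (sg x1 y1) (sg x2 y2) (sg x3 y3) (sg x4 y4) c.
Proof.
move=> hc.
have [a [b [e [F sub sp [d sd]]]]] := @conic_frame_exists _ s erefl cop irr s_isotropic.
have [X [Y [Z []]]] := conic_frame_point d F.
set o := X *: a + Y *: b + Z *: e => Z0 oo no.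
have so : in_span s o.
  apply: (@in_span_sub _ _ [:: a; b; e]) => [v /sub|]; first exact: in_span_mem.
  by apply/in_span3; exists X, Y, Z.
have {}no v : v \in s -> ~ in_span [:: v] o by move/sd; exact: no.
have [x0 [y0 eo]] := isotropic_segre (s_span so) oo.
have frame1 x y : sg x y \in s -> exists2 k, k != 0 &
    L y0 (sg x y) = (k * x.1, k * x.2).
  move=> m; exists (kap * det2 y y0); last exact: L_segre.
  exact: off_conic so oo eo m (no _ m).
have proj x y : sg x y \in s -> exists w : C * C, let u := w.1 *: a + w.2 *: b in
    [/\ u != 0, in_span [:: o; sg x y] u & exists2 k, k != 0 &
     (k * x.1, k * x.2) = (w.1 * (L y0 a).1 + w.2 * (L y0 b).1,
                          w.1 * (L y0 a).2 + w.2 * (L y0 b).2)].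
  move=> m; have /in_span3[al [be [ga ev]]] := sp _ m.
  (* Subtracting [ga / Z] times [o] cancels the third frame coordinate of the vertex. *)
  exists (al - ga / Z * X, be - ga / Z * Y) => u.
  have eu : u = (- (ga / Z)) *: o + 1 *: sg x y.
    by rewrite ev /u /o; apply/colP => i; rewrite !mxE /=; field.
  split; last first.
  - have [k k0 ek] := frame1 _ _ m; exists k => //; rewrite -ek -L_comb -/u eu.
    rewrite L_comb eo !(L_segre y0 x0 y0) det2xx mulr0 !mul0r !mulr0 !add0r !mul1r.
    by rewrite -surjective_pairing.
  - by apply/in_span2; exists (- (ga / Z)), 1.
  apply/eqP => u0; have := m; move: eu; rewrite u0 scale1r => /esym/eqP.
  rewrite addrC addr_eq0 scaleNr opprK => /eqP es _.
  have g0 : ga / Z != 0.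
    by apply: contraNneq s0 => g0; rewrite -(scale0r o) -g0 -es.
  apply: (no _ m); apply/in_span1; exists (ga / Z)^-1.
  by rewrite es scalerA mulVf // scale1r.
have s1 : sg x1 y1 \in s by rewrite mem_head.
have s2 : sg x2 y2 \in s by rewrite !inE eqxx !orbT.
have s3 : sg x3 y3 \in s by rewrite !inE eqxx !orbT.
have s4 : sg x4 y4 \in s by rewrite !inE eqxx !orbT.
have [w1 [u1 i1 [k1 n1 h1]]] := proj _ _ s1.
have [w2 [u2 i2 [k2 n2 h2]]] := proj _ _ s2.
have [w3 [u3 i3 [k3 n3 h3]]] := proj _ _ s3.
have [w4 [u4 i4 [k4 n4 h4]]] := proj _ _ s4.
have sa : a \in s by apply: sub; rewrite !inE eqxx.
have sb : b \in s by apply: sub; rewrite !inE eqxx orbT.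
have ind : indep2 a b.
  move=> p q h; have [] // := @conic_frame_uniq _ _ _ _ p q 0 0 0 0 F.
  by rewrite h !scale0r !addr0.
have o0 : o != 0 by apply/eqP => o0; apply: (no _ s1); rewrite o0; exact: in_span0.
exists o, a, b; split; [by [] | by [] | exact: so | exact: no |].
split; [exact: in_span_mem | exact: in_span_mem | exact: ind | | ].
  move/in_span2 => [p [q h]]; case/eqP: Z0.
  have [] // := @conic_frame_uniq _ _ _ _ X Y Z p q 0 F.
  by rewrite -/o h scale0r addr0.
exists (w1.1 *: a + w1.2 *: b), (w2.1 *: a + w2.2 *: b),
  (w3.1 *: a + w3.2 *: b), (w4.1 *: a + w4.2 *: b); split.
  have inab (w : C * C) : in_span [:: a; b] (w.1 *: a + w.2 *: b).
    by apply/in_span2; exists w.1, w.2.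
  by move=> yx; rewrite !inE => /or4P[] /eqP-> /=; split=> //; exact: inab.
exists a, b; split=> //; exists w1, w2, w3, w4; split=> //.
have D0 : det2 (L y0 a) (L y0 b) != 0.
  have [xa [ya ea]] := s_segre sa; have [xb [yb eb]] := s_segre sb.
  have [_ [ab _ _]] := F; move: ab sa sb; rewrite ea eb.
  rewrite pform_segre_neq0 => /andP[dx _] /frame1[ka ka0 ->] /frame1[kb kb0 ->].
  by rewrite det2Zr det2C det2Zr !mulf_neq0 // oppr_eq0 mulf_neq0 // det2C oppr_eq0.
by apply/(peq1_cr_transfer _ n1 n2 n3 n4 D0 (det2_comb h1 h2)
  (det2_comb h3 h4) (det2_comb h2 h3) (det2_comb h4 h1)).
Qed.

End Face.
End Form.
End Segre.

(** Expanding the product of the two [fourth] vectors leaves mixed terms in [x1], [y3] and [x3],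
    [y1] with common factor [lam]. The identity [det2 x1 x3 * x2 = det2 x2 x3 * x1 + det2 x1 x2 *
    x3] and its analogue for [y] express the sum of these terms through the three given vertices;
    this yields the coefficients. *)
Lemma segre_fourth_coplanar {C : numClosedFieldType} (g11 g12 g21 g22 : 'cV[C]_6)
    (lam k k' : C) (x1 x2 x3 y1 y2 y3 : C * C) :
  let x := fourth lam x2 x1 x3 in let y := fourth lam y2 y1 y3 in
  coplanar [:: segre g11 g12 g21 g22 x1 y1; segre g11 g12 g21 g22 x2 y2;
    segre g11 g12 g21 g22 x3 y3;
    segre g11 g12 g21 g22 (k * x.1, k * x.2) (k' * y.1, k' * y.2)].
Proof.
move=> x y; apply/coplanar4P.
exists (k * k' * (lam ^+ 2 - lam) * det2 x2 x3 * det2 y2 y3),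
  (k * k' * lam * det2 x1 x3 * det2 y1 y3),
  (k * k' * (1 - lam) * det2 x1 x2 * det2 y1 y2), (- 1).
split; first by rewrite oppr_eq0 oner_eq0 !orbT.
by apply/colP => i; rewrite !mxE /x /y /fourth /det2 /=; ring.
Qed.

Section CoplanarPerm.
Context {C : numClosedFieldType}.
Implicit Types (a b c d : 'cV[C]_6).

Lemma coplanar_swap12 a b c d :
  coplanar [:: a; b; c; d] -> coplanar [:: b; a; d; c].
Proof.
move/coplanar4P => [x [y [z [t [h e]]]]]; apply/coplanar4P; exists y, x, t, z.
split; first by case/or4P: h => ->; rewrite ?orbT.
by rewrite -e; apply/colP => i; rewrite !mxE; ring.
Qed.

Lemma coplanar_swap13 a b c d :
  coplanar [:: a; b; c; d] -> coplanar [:: c; d; a; b].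
Proof.
move/coplanar4P => [x [y [z [t [h e]]]]]; apply/coplanar4P; exists z, t, x, y.
split; first by case/or4P: h => ->; rewrite ?orbT.
by rewrite -e; apply/colP => i; rewrite !mxE; ring.
Qed.

Lemma coplanar_swap14 a b c d :
  coplanar [:: a; b; c; d] -> coplanar [:: d; c; b; a].
Proof. by move/coplanar_swap12/coplanar_swap13. Qed.

End CoplanarPerm.

(** * Cauchy problems on the lattice *)

Definition nearc (m : int) : int := if 0 <= m then m else m + 1.
Definition farc (m : int) : int := if 0 <= m then m + 1 else m.

(* Read from the vertex nearest to the axes, a face is the original one up to a
   permutation in the Klein four-group, which fixes the cross-ratio. *)
Definition orientedFace {T : Type} (f : int -> int -> T) m n : seq T :=
  [:: f (farc m) (nearc n); f (nearc m) (nearc n); f (nearc m) (farc n);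
      f (farc m) (farc n)].

Section Faces.
Context {C : numClosedFieldType}.
Implicit Types (phi : int -> int -> 'cV[C]_6) (z : int -> int -> C * C).

Lemma cr_orient z m n :
  cr (z (m + 1) n) (z m n) (z m (n + 1)) (z (m + 1) (n + 1)) =
  cr (z (farc m) (nearc n)) (z (nearc m) (nearc n)) (z (nearc m) (farc n))
     (z (farc m) (farc n)).
Proof.
rewrite /farc /nearc; case: ifP => _; case: ifP => _ //.
- by rewrite cr_swap14.
- by rewrite cr_swap12.
by rewrite cr_swap13.
Qed.

Lemma faceV_orient phi m n : faceV phi m n =i orientedFace phi m n.
Proof.
move=> x; rewrite /orientedFace /farc /nearc; case: ifP => _; case: ifP => _;
  rewrite /faceV /= !in_cons in_nil;
  by move: (x == phi (m + 1) n) (x == phi m n) (x == phi m (n + 1))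
    (x == phi (m + 1) (n + 1)) => [] [] [] [].
Qed.

Lemma coplanar_orient phi m n :
  coplanar (faceV phi m n) <-> coplanar (orientedFace phi m n).
Proof.
rewrite /orientedFace /farc /nearc; case: ifP => _; case: ifP => _ //;
  [split; exact: coplanar_swap14 | split; exact: coplanar_swap12
  | split; exact: coplanar_swap13].
Qed.

Lemma nearV_orient phi m n :
  nearV phi m n =i [:: phi (farc m) (nearc n); phi (nearc m) (nearc n);
                       phi (nearc m) (farc n)].
Proof.
move=> x; rewrite /nearV /farCorner /farc /nearc.
have e (k : int) : (k + 1 == k) = false by lia.
have e' (k : int) : (k == k + 1) = false by lia.
case: ifP => _; case: ifP => _;
  rewrite /= !xpair_eqE ?e ?e' ?eqxx /= !in_cons in_nil;
  by move: (x == phi (m + 1) n) (x == phi m n) (x == phi m (n + 1))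
    (x == phi (m + 1) (n + 1)) => [] [] [] [].
Qed.

End Faces.

Lemma irredConic_eq_mem {C : numClosedFieldType} (s t : seq 'cV[C]_6) :
  s =i t -> irredConic s -> irredConic t.
Proof. by move=> e; apply: irredConic_sub => x xs; apply: in_span_mem; rewrite -e. Qed.

Definition signed (s : bool) (a : nat) : int := if s then a%:Z else - a%:Z.
(** The interval at distance [a] from 0 on the side [s], indexed by its left end; hence the
    successor on the negative side. *)
Definition faceOf (s : bool) (a : nat) : int := if s then a%:Z else - (a.+1)%:Z.

Lemma farc_faceOf s a : farc (faceOf s a) = signed s a.+1.
Proof. by rewrite /farc /faceOf /signed; case: s => /=; lia. Qed.

Lemma nearc_faceOf s a : nearc (faceOf s a) = signed s a.
Proof. by rewrite /nearc /faceOf /signed; case: s => /=; lia. Qed.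

Lemma signedP m : exists s a, m = signed s a.
Proof. by case: m => a; [exists true, a | exists false, a.+1]. Qed.

Lemma faceOfP m : exists s a, m = faceOf s a.
Proof. by case: m => a; [exists true, a | exists false, a]. Qed.

(** Every vertex off the axes is the far corner of a face whose other corners are nearer to the
    axes, in whichever quadrant it lies. *)
Lemma vertex_ind (P : int -> int -> Prop) :
  (forall k, P k 0) -> (forall n, P 0 n) ->
  (forall m n, P (farc m) (nearc n) -> P (nearc m) (nearc n) ->
     P (nearc m) (farc n) -> P (farc m) (farc n)) ->
  forall k n, P k n.
Proof.
move=> Ph Pv Pf k n; have [s [a ->]] := signedP k; have [t [b ->]] := signedP n.
elim: a b => [|a IHa] b; first by case: (s); rewrite /signed ?oppr0.
elim: b => [|b IHb]; first by case: (t); rewrite /signed ?oppr0.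
have := Pf (faceOf s a) (faceOf t b); rewrite !farc_faceOf !nearc_faceOf.
by apply.
Qed.

(** Induction on the sum of the distances [r] to the axes. Since [betw0] preserves the side, equal
    distances inside a rectangle mean equal indices. *)
Lemma face_ind (P : int -> int -> Prop) :
  (forall m n, (forall m' n', inRect m' n' m n -> (m', n') != (m, n) -> P m' n') ->
     P m n) ->
  forall m n, P m n.
Proof.
move=> IH; pose r (m : int) : nat := if m is Negz a then a else `|m|%N.
suff H N m n : (r m + r n < N)%N -> P m n by move=> m n; apply: (H (r m + r n).+1).
elim: N m n => // N IHN m n lt; apply: IH => m' n' /andP[hm hn] ne; apply: IHN.
have R k k' : betw0 k' k -> (r k' <= r k)%N /\ (r k' = r k -> k' = k).
  by case: k k' => k [] k'; rewrite /betw0 /r /=; lia.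
have [h1 h2] := R _ _ hm; have [h3 h4] := R _ _ hn.
suff : r m' <> r m \/ r n' <> r n by lia.
have [e|] := eqVneq (r m') (r m); last by move/eqP; left.
by right => e'; move: ne; rewrite (h2 e) (h4 e') eqxx.
Qed.

Section Goursat.
Context {T : Type}.
Variables (h v : int -> T) (F : int -> int -> T -> T -> T -> T).

(** A vertex needs its predecessor with the same [a] and two vertices with the preceding [a]; the
    nested [fix] makes this lexicographic recursion structural. *)
Fixpoint quadrant (s t : bool) (a : nat) : nat -> T :=
  if a is a'.+1 then
    fix row (b : nat) : T :=
      if b is b'.+1 then
        F (faceOf s a') (faceOf t b') (row b') (quadrant s t a' b')
          (quadrant s t a' b'.+1)
      else h (signed s a)
  else fun b => v (signed t b).

Lemma goursat : h 0 = v 0 -> exists f : int -> int -> T,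
  [/\ forall k, f k 0 = h k, forall n, f 0 n = v n &
   forall m n, f (farc m) (farc n) =
     F m n (f (farc m) (nearc n)) (f (nearc m) (nearc n)) (f (nearc m) (farc n))].
Proof.
move=> hv0; pose f m n := quadrant (0 <= m) (0 <= n) `|m|%N `|n|%N.
(* Zero has both signs, so the quadrants overlap on the axes; there the values come from [h] or [v]
   and do not depend on the ambiguous sign. *)
have fE s t a b : f (signed s a) (signed t b) = quadrant s t a b.
  have Es a0 : (0 <= signed s a0.+1) = s by case: (s); rewrite /signed; lia.
  have Et b0 : (0 <= signed t b0.+1) = t by case: (t); rewrite /signed; lia.
  have abs s' a' : `|signed s' a'|%N = a' by case: s'; rewrite /signed ?abszN.
  rewrite /f !abs; case: a => [|a].
    case: b => [|b] /=; last by rewrite Et.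
    by case: (0 <= _); case: (t); rewrite /signed ?oppr0.
  by rewrite Es; case: b => [|b] //=; rewrite Et.
exists f; split=> [k|n|m n].
- have [s [a ->]] := signedP k; rewrite -[0 in LHS]/(signed true 0) fE.
  by case: a => [|a] //=; case: s; rewrite /signed ?oppr0.
- by have [t [b ->]] := signedP n; rewrite -[0 in LHS]/(signed true 0) fE.
have [s [a ->]] := faceOfP m; have [t [b ->]] := faceOfP n.
by rewrite !farc_faceOf !nearc_faceOf !fE.
Qed.

End Goursat.

(** * Twistor geometry of a sphere *)

Section Twistor.
Context {C : numClosedFieldType}.
Implicit Types (u v w : 'cV[C]_4) (x y : C * C).

Lemma jpartnerK (i : 'I_4) :
  jpartner (jpartner i) = i /\ odd (jpartner i) = ~~ odd i.
Proof.
by case: i => [[|[|[|[|//]]]] hi]; rewrite /jpartner /= ?inordK //; split=> //;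
  apply/val_inj; rewrite /= inordK.
Qed.

Lemma JqD u v : Jq (u + v) = Jq u + Jq v.
Proof.
by apply/colP => i; rewrite !mxE; case: ifP => _; rewrite rmorphD ?opprD.
Qed.

Lemma JqZ (k : C) v : Jq (k *: v) = k^* *: Jq v.
Proof.
by apply/colP => i; rewrite !mxE; case: ifP => _; rewrite rmorphM ?mulrN.
Qed.

Lemma JqK v : Jq (Jq v) = - v.
Proof.
apply/colP => i; rewrite !mxE; have [-> ->] := jpartnerK i.
by case: (odd i); rewrite /= ?rmorphN /= conjCK.
Qed.

Lemma wedgeDl u v w : wedge (u + v) w = wedge u w + wedge v w.
Proof. by apply/colP => i; rewrite !mxE; ring. Qed.

Lemma wedgeZl (k : C) u w : wedge (k *: u) w = k *: wedge u w.
Proof. by apply/colP => i; rewrite !mxE; ring. Qed.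

Lemma wedgeC u w : wedge u w = - wedge w u.
Proof. by apply/colP => i; rewrite !mxE; ring. Qed.

Lemma wedgeDr u v w : wedge w (u + v) = wedge w u + wedge w v.
Proof. by apply/colP => i; rewrite !mxE; ring. Qed.

Lemma wedgeZr (k : C) u w : wedge w (k *: u) = k *: wedge w u.
Proof. by apply/colP => i; rewrite !mxE; ring. Qed.

Lemma wedgexx u : wedge u u = 0.
Proof. by apply/colP => i; rewrite !mxE; ring. Qed.

(** On decomposable bivectors the form is the determinant of the four vectors; these are two
    instances of its alternation. *)
Lemma pform_wedge_alt u v w (t : 'cV[C]_4) :
  pform (wedge u v) (wedge u w) = 0 /\
  pform (wedge u v) (wedge w t) = - pform (wedge u w) (wedge v t).
Proof.
by rewrite /pform !big_ord_recl !big_ord0 !mxE /psign /pfst /psnd /=; split; ring.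
Qed.

Lemma pform_wedge_shared u v w :
  [/\ pform (wedge u v) (wedge u w) = 0, pform (wedge v u) (wedge w u) = 0,
      pform (wedge u v) (wedge w u) = 0 & pform (wedge v u) (wedge u w) = 0].
Proof.
have [h _] := pform_wedge_alt u v w 0.
rewrite (wedgeC v) (wedgeC w) -!scaleN1r !(pformZl, pformZr) h.
by rewrite !mulr0.
Qed.

Definition comb2 u v x := x.1 *: u + x.2 *: v.

Lemma wedge_comb2 (e1 e2 f1 f2 : 'cV[C]_4) x y :
  wedge (comb2 e1 e2 x) (comb2 f1 f2 y) =
  segre (wedge e1 f1) (wedge e1 f2) (wedge e2 f1) (wedge e2 f2) x y.
Proof.
rewrite /comb2 /segre !(wedgeDl, wedgeDr, wedgeZl, wedgeZr).
by apply/colP => i; rewrite !mxE; ring.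
Qed.

(** Pairings of wedges with a common vector vanish. Up to symmetry two remain, and they are
    opposite, which produces the product of two determinants. *)
Lemma pform_segre_wedge (e1 e2 f1 f2 : 'cV[C]_4) x y x' y' :
  let sg := segre (wedge e1 f1) (wedge e1 f2) (wedge e2 f1) (wedge e2 f2) in
  pform (sg x y) (sg x' y') =
  pform (wedge e1 f1) (wedge e2 f2) * det2 x x' * det2 y y'.
Proof.
rewrite /segre /= !(pformDl, pformDr, pformZl, pformZr).
have s0 a b c := pform_wedge_shared a b c.
have [-> _ _ _] := s0 e1 f1 f1; have [-> _ _ _] := s0 e1 f1 f2.
have [-> _ _ _] := s0 e1 f2 f1; have [-> _ _ _] := s0 e1 f2 f2.
have [-> _ _ _] := s0 e2 f1 f1; have [-> _ _ _] := s0 e2 f1 f2.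
have [-> _ _ _] := s0 e2 f2 f1; have [-> _ _ _] := s0 e2 f2 f2.
have [_ -> _ _] := s0 f1 e1 e2; have [_ -> _ _] := s0 f1 e2 e1.
have [_ -> _ _] := s0 f2 e1 e2; have [_ -> _ _] := s0 f2 e2 e1.
have e : pform (wedge e1 f2) (wedge e2 f1) = - pform (wedge e1 f1) (wedge e2 f2).
  have [_ ->] := pform_wedge_alt e1 f2 e2 f1.
  rewrite (wedgeC f2) -scaleN1r pformZr mulN1r opprK.
  by have [_ ->] := pform_wedge_alt e1 e2 f1 f2.
rewrite (pformC (wedge e2 f1)) (pformC (wedge e2 f2)) e /det2; ring.
Qed.

Lemma in_wedge_span (us : seq 'cV[C]_4) (ws : seq 'cV[C]_6) u v :
  (forall a b, a \in us -> b \in us -> in_span ws (wedge a b)) ->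
  in_span us u -> in_span us v -> in_span ws (wedge u v).
Proof.
move=> h [cs [_ ->]] [ds [_ ->]].
elim/big_rec: _ => [|i w _ IH].
  by rewrite -(scale0r 0) wedgeZl scale0r; exact: in_span0.
rewrite wedgeDl; apply: in_spanD IH; rewrite wedgeZl; apply: in_spanZ.
elim/big_rec: _ => [|j w' _ IH].
  by rewrite -(scale0r 0) wedgeZr scale0r; exact: in_span0.
rewrite wedgeDr; apply: in_spanD IH; rewrite wedgeZr; apply: in_spanZ.
by apply: h; apply: mem_nth.
Qed.

Lemma bivector_span (us : seq 'cV[C]_4) (ws : seq 'cV[C]_6) a :
  (forall u, in_span us u) ->
  (forall u v, u \in us -> v \in us -> in_span ws (wedge u v)) -> in_span ws a.
Proof.
move=> sp h.
have -> : a = \sum_(i < 6) a i 0 *: wedge (delta_mx (pfst i) 0) (delta_mx (psnd i) 0).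
  apply/colP => k; rewrite summxE.
  rewrite !big_ord_recl big_ord0 !mxE /pfst /psnd /=.
  by case: k => [[|[|[|[|[|[|//]]]]]] hk];
    rewrite -!val_eqE /= !inordK //= ?(oppr0, mulr0, mul0r, mulr1, subr0, addr0, add0r);
    congr (fun_of_matrix a _ _); apply: val_inj.
elim/big_rec: _ => [|i w _ IH]; first exact: in_span0.
by apply: in_spanD IH; apply: in_spanZ; exact: in_wedge_span h (sp _) (sp _).
Qed.

End Twistor.

(** * The eigenspaces of [S] and coordinates on [Q^2_S] *)

Section TwistorFrame.
Context {C : numClosedFieldType}.
Implicit Types (u v w e : 'cV[C]_4) (x y z : C * C).

Lemma pform_span0 (ws : seq 'cV[C]_6) (a b : 'cV[C]_6) :
  (forall c, c \in ws -> pform c b = 0) -> in_span ws a -> pform a b = 0.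
Proof.
elim: ws a => [|w ws IH] a h; first by rewrite in_span_nil => ->; exact: pform0l.
rewrite in_span_cons => -[c [a' [ha ->]]].
rewrite pformDl pformZl h ?mem_head // mulr0 add0r; apply: IH => // w' hw'.
by apply: h; rewrite inE hw' orbT.
Qed.

Lemma pform_nondegenerate (a : 'cV[C]_6) : (forall b, pform b a = 0) -> a = 0.
Proof.
move=> h; apply/colP => i; have := h (delta_mx (rev_ord i) 0).
rewrite /pform (bigD1 (rev_ord i)) //= big1 => [|j ji]; last first.
  by rewrite mxE (negPf ji) mulr0 mul0r.
rewrite rev_ordK !mxE !eqxx mulr1 addr0 => /mulf_eq0_r; apply.
by rewrite /psign; case: ifP; rewrite ?oppr_eq0 oner_eq0.
Qed.

Lemma wedge_eq0 u v : wedge u v = 0 -> forall i j, u i 0 * v j 0 = u j 0 * v i 0.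
Proof.
move=> h i j; have {}h k : wedge u v (inord k) 0 = 0 by rewrite h mxE.
move: (h 0%N) (h 1%N) (h 2%N) (h 3%N) (h 4%N) (h 5%N).
rewrite !mxE /pfst /psnd !inordK //= => /subr0_eq h0 /subr0_eq h1 /subr0_eq h2.
move=> /subr0_eq h3 /subr0_eq h4 /subr0_eq h5.
rewrite -[i]inord_val -[j]inord_val.
case: i => [[|[|[|[|//]]]] ?] /=; case: j => [[|[|[|[|//]]]] ?] //=;
  by rewrite ?(h0, h1, h2, h3, h4, h5).
Qed.

Lemma wedge_indep u v : indep2 u v -> wedge u v != 0.
Proof.
move=> ind; apply/eqP => /wedge_eq0 h.
have u0 : u != 0.
  apply/eqP => u0; have [] := ind 1 0; first by rewrite u0 scaler0 scale0r addr0.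
  by move/eqP; rewrite oner_eq0.
have [k hk] : exists k, u k 0 != 0.
  apply/existsP; apply: contraNT u0 => /existsPn hu; apply/eqP/colP => k.
  by rewrite mxE; have := hu k; rewrite negbK => /eqP.
have [|_ /eqP] := ind (v k 0) (- u k 0); last by rewrite oppr_eq0 (negPf hk).
by apply/colP => i; rewrite !mxE mulNr h mulrC subrr.
Qed.

Lemma span2_proper u v : exists w, ~~ (w^T <= u^T + v^T)%MS.
Proof.
have /row_subPn[i hi] : ~~ ((1%:M : 'M[C]_4) <= u^T + v^T)%MS.
  apply/negP => /mxrankS; rewrite mxrank1 => h.
  have := leq_trans h (mxrank_adds_leqif u^T v^T).
  have := leq_add (rank_leq_row u^T) (rank_leq_row v^T).
  by move=> a b; have := leq_trans b a.
by exists (row i 1%:M)^T; rewrite trmxK.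
Qed.

Variable S : 'M[C]_4.
Hypothesis HS : quat_cpx_str S.

Lemma twL_conj u : twL S u -> S *m Jq u = - 'i *: Jq u.
Proof. by case: HS => SJ _ h; rewrite SJ h JqZ conjCi. Qed.

Lemma twL_Jq u : S *m u = - 'i *: u -> twL S (Jq u).
Proof. by case: HS => SJ _ h; rewrite /twL SJ h JqZ rmorphN /= conjCi opprK. Qed.

(** A vector [v] outside the span of [e] and [Jq e] splits into eigenvectors [p] and [q] for ['i]
    and [- 'i]. Both [p] and [Jq q] are candidates; if both were multiples of [e], then [v] would
    lie in the excluded span. *)
Lemma twL_off e : twL S e -> exists2 u, twL S u & ~ in_span [:: e] u.
Proof.
move=> he; have [SJ SS] := HS; have [v hv] := span2_proper e (Jq e).
pose p := 2^-1 *: (v - 'i *: (S *m v)); pose q := 2^-1 *: (v + 'i *: (S *m v)).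
have two : (2 : C) != 0 by rewrite pnatr_eq0.
have SSv : S *m (S *m v) = - v by rewrite mulmxA SS mulNmx mul1mx.
have Sp : twL S p.
  rewrite /twL /p -scalemxAr mulmxBr -scalemxAr SSv scalerA mulrC -scalerA.
  by congr (_ *: _); rewrite scalerBr scalerA -expr2 sqrCi scaleN1r scalerN !opprK addrC.
have Sq : S *m q = - 'i *: q.
  rewrite /q -scalemxAr mulmxDr -scalemxAr SSv scalerA mulrC -scalerA.
  by congr (_ *: _); rewrite scalerDr scalerA mulNr -expr2 sqrCi opprK scale1r
    scalerN scaleNr addrC.
have vpq : v = p + q.
  by rewrite /p /q -scalerDr addrACA addNr addr0 -[v in v + v]scale1r -scalerDl
    -mulr2n scalerA mulVf ?scale1r.
have sub1 (a b : 'cV[C]_4) : in_span [:: a] b -> (b^T <= a^T)%MS.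
  by move/in_span1 => [k ->]; rewrite linearZ scalemx_sub.
have [pe | pe] := boolP (p^T <= e^T)%MS; last first.
  by exists p => //; move/sub1; exact/negP.
exists (Jq q); first exact: twL_Jq.
move/in_span1 => [k hk]; case/negP: hv.
have eq : q = - k^* *: Jq e by rewrite -[LHS]opprK -(JqK q) hk JqZ scaleNr.
have -> : v = p + - k^* *: Jq e by rewrite vpq eq.
by rewrite linearD /=; apply: addmx_sub_adds => //; rewrite linearZ; exact: scalemx_sub.
Qed.

Definition twistor_frame (e1 e2 : 'cV[C]_4) :=
  [/\ twL S e1, twL S e2 & indep2 e1 e2].

Lemma twistor_frame_exists : exists e1 e2, twistor_frame e1 e2.
Proof.
(* Starting from the zero vector gives a nonzero eigenvector. *)
have [|e1 h1 n1] := @twL_off 0; first by rewrite /twL mulmx0 scaler0.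
have [e2 h2 n2] := twL_off h1; exists e1, e2; split=> // s t h.
have [t0 | t0] := eqVneq t 0; last first.
  case: n2; apply/in_span1; exists (- (t^-1 * s)); apply/eqP.
  by rewrite scaleNr -addr_eq0 -[e2]scale1r -(mulVf t0) -!scalerA -scalerDr
    addrC h scaler0.
split=> //; move/eqP: h; rewrite t0 scale0r addr0 scaler_eq0 => /orP[/eqP // | /eqP e10].
by case: n1; rewrite e10; exact: in_span0.
Qed.

Section Frame.
Variables e1 e2 : 'cV[C]_4.
Hypothesis F : twistor_frame e1 e2.
Let f1 := Jq e1.
Let f2 := Jq e2.
Let us := [:: e1; e2; f1; f2].

Definition conj2 x := (x.1^*, x.2^*).

Lemma Jq_comb2 x : Jq (comb2 e1 e2 x) = comb2 f1 f2 (conj2 x).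
Proof. by rewrite /comb2 JqD !JqZ. Qed.

Lemma conj2_neq0 x : x != (0, 0) -> conj2 x != (0, 0).
Proof. by rewrite !pair_neq0 /= !conjC_eq0. Qed.

Lemma twL_comb2 x : twL S (comb2 e1 e2 x).
Proof.
case: F => h1 h2 _.
by rewrite /twL /comb2 mulmxDr -!scalemxAr h1 h2 scalerDr !scalerA ![_ * 'i]mulrC.
Qed.

Lemma comb2_neq0 x : (comb2 e1 e2 x != 0) = (x != (0, 0)).
Proof.
case: F => _ _ ind; apply/idP/idP; apply: contraNneq.
  by move=> ->; rewrite /comb2 /= !scale0r addr0.
by move/ind => [h1 h2]; rewrite (surjective_pairing x) h1 h2.
Qed.

Lemma eigen_split x y : twL S (comb2 e1 e2 x + comb2 f1 f2 y) -> comb2 f1 f2 y = 0.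
Proof.
have [h1 h2 _] := F; rewrite /twL mulmxDr twL_comb2.
have -> : S *m comb2 f1 f2 y = - 'i *: comb2 f1 f2 y.
  rewrite /comb2 mulmxDr -!scalemxAr (twL_conj h1) (twL_conj h2) scalerDr !scalerA.
  by rewrite ![_ * - 'i]mulrC.
rewrite (scalerDr 'i (comb2 e1 e2 x)) => /addrI/eqP.
rewrite -subr_eq0 -scalerBl -opprD -mulr2n.
by rewrite scaler_eq0 oppr_eq0 mulrn_eq0 (negPf (neq0Ci C)) => /eqP.
Qed.

Lemma Jframe_indep : indep2 f1 f2.
Proof.
case: F => _ _ ind s t h; have := ind s^* t^*.
have -> : s^* *: e1 + t^* *: e2 = - Jq (s *: f1 + t *: f2).
  by rewrite JqD !JqZ /f1 /f2 !JqK !scalerN -opprD opprK.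
rewrite h; have -> : Jq (0 : 'cV[C]_4) = 0 by rewrite -(scale0r 0) JqZ rmorph0 !scale0r.
by rewrite oppr0 => /(_ erefl)[/eqP + /eqP]; rewrite !conjC_eq0 => /eqP -> /eqP ->.
Qed.

Lemma frame_indep x y : comb2 e1 e2 x + comb2 f1 f2 y = 0 -> x = (0, 0) /\ y = (0, 0).
Proof.
move=> h; have hy : comb2 f1 f2 y = 0.
  by apply: (@eigen_split x); rewrite h /twL mulmx0 scaler0.
move: h; rewrite hy addr0 => hx; have [_ _ ind] := F.
have [a b] := ind _ _ hx; have [c d] := Jframe_indep hy.
by rewrite (surjective_pairing x) (surjective_pairing y) a b c d.
Qed.

Lemma frame_span v : in_span us v.
Proof.
pose B : 'M[C]_4 := \matrix_(i, j) us`_j i 0.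
have BE (w : 'cV[C]_4) : B *m w = \sum_(j < 4) w j 0 *: us`_j.
  by apply/colP => i; rewrite mxE summxE; apply: eq_bigr => j _; rewrite !mxE mulrC.
have uB : B \in unitmx.
  rewrite unitmxE unitfE -det_tr; apply/det0P => -[w w0 h].
  have {h}: B *m w^T = 0 by rewrite -[B]trmxK -trmx_mul h trmx0.
  rewrite BE !big_ord_recl big_ord0 /= addr0 !mxE !addrA -addrA => h.
  have [[a b] [c d]] := @frame_indep (_, _) (_, _) h.
  case/negP: w0; apply/eqP/rowP => k; rewrite mxE.
  move: a b c d; case: k => [[|[|[|[|//]]]] hk] a b c d;
    [rewrite -a | rewrite -b | rewrite -c | rewrite -d];
    by congr (fun_of_matrix w _ _); apply: val_inj.
rewrite -[v](mulKVmx uB) BE; elim/big_rec: _ => [|j w _ IH]; first exact: in_span0.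
by apply: in_spanD IH; apply/in_spanZ/in_span_mem/mem_nth.
Qed.

Lemma twL_comb2P v : twL S v -> exists x, v = comb2 e1 e2 x.
Proof.
have /in_span_cons[a [w [/in_span3[b [c [d ->]]] ->]]] := frame_span v.
have -> : a *: e1 + (b *: e2 + c *: f1 + d *: f2) =
  comb2 e1 e2 (a, b) + comb2 f1 f2 (c, d) by rewrite /comb2 /= !addrA.
by move/eigen_split=> ->; exists (a, b); rewrite addr0.
Qed.

Let g11 := wedge e1 f1.
Let g12 := wedge e1 f2.
Let g21 := wedge e2 f1.
Let g22 := wedge e2 f2.
Definition twistor_segre := segre g11 g12 g21 g22.
Definition twistor_kap := pform g11 g22.

Let pform_E : pform (wedge f1 f2) (wedge e1 e2) = - twistor_kap.
Proof. by rewrite pformC; have [_ ->] := pform_wedge_alt e1 e2 f1 f2. Qed.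

(** Among the wedges of frame vectors only [wedge e2 f2], up to sign, can pair nontrivially with
    [wedge e1 f1]. If that pairing vanished, [wedge e1 f1] would be in the radical of the form. *)
Lemma twistor_kap_neq0 : twistor_kap != 0.
Proof.
apply/eqP => k0.
have : wedge e1 f1 != 0.
  apply: wedge_indep => s t h.
  have hs : comb2 e1 e2 (s, 0) + comb2 f1 f2 (t, 0) = 0.
    by rewrite /comb2 /= !scale0r !addr0.
  by have [/(congr1 fst) /= -> /(congr1 fst) /= ->] := frame_indep hs.
case/eqP; apply: pform_nondegenerate => b.
apply: (@pform_span0 [seq wedge u v | u <- us, v <- us]); last first.
  apply: (@bivector_span _ us) => [|u v hu hv]; first exact: frame_span.
  by apply/in_span_mem/allpairsP; exists (u, v).
move=> _ /allpairsP[[u v] [/= hu hv ->]].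
have k0' : pform (wedge e2 f2) (wedge e1 f1) = 0 by rewrite pformC.
have k0'' : pform (wedge f2 e2) (wedge e1 f1) = 0.
  by rewrite (wedgeC f2) -scaleN1r pformZl k0' mulr0.
have s0 := pform_wedge_shared.
move: hu hv; rewrite !inE => /or4P[] /eqP-> /or4P[] /eqP->;
  rewrite ?wedgexx ?pform0l //;
  by [case: (s0 _ e1 e2 f1) | case: (s0 _ e1 f1 f1) | case: (s0 _ e1 f2 f1)
  | case: (s0 _ f1 e1 e1) | case: (s0 _ f1 e2 e1) | case: (s0 _ f1 f2 e1)].
Qed.

Lemma twistor_segre_form : segre_form g11 g12 g21 g22 twistor_kap.
Proof. by split; [exact: twistor_kap_neq0 | exact: pform_segre_wedge]. Qed.

Lemma wedge_twistor x y : wedge (comb2 e1 e2 x) (comb2 f1 f2 y) = twistor_segre x y.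
Proof. exact: wedge_comb2. Qed.

Lemma realpt_twistor x : realpt (comb2 e1 e2 x) = twistor_segre x (conj2 x).
Proof. by rewrite /realpt Jq_comb2 wedge_twistor. Qed.

Let orthE g : g \in [:: g11; g12; g21; g22] ->
  pform g (wedge e1 e2) = 0 /\ pform g (wedge f1 f2) = 0.
Proof.
have s0 := pform_wedge_shared.
rewrite !inE => /or4P[] /eqP->; split;
  by [case: (s0 _ e1 f1 e2) | case: (s0 _ e1 f2 e2) | case: (s0 _ e2 f1 e1)
    | case: (s0 _ e2 f2 e1) | case: (s0 _ f1 e1 f2) | case: (s0 _ f2 e1 f1)
    | case: (s0 _ f1 e2 f2) | case: (s0 _ f2 e2 f1)].
Qed.

Lemma wedge_comb2_same u v x y :
  wedge (comb2 u v x) (comb2 u v y) = det2 x y *: wedge u v.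
Proof. by apply/colP => i; rewrite !mxE /det2; ring. Qed.

Lemma Q2S_segre x y : x != (0, 0) -> y != (0, 0) -> Q2S S (twistor_segre x y).
Proof.
move=> x0 y0; split.
- by rewrite (segre_neq0 twistor_segre_form) x0.
- exact: segre_isotropic twistor_segre_form _ _.
have orth (w : 'cV[C]_6) : w \in [:: wedge e1 e2; wedge f1 f2] ->
    pform (twistor_segre x y) w = 0.
  move=> hw; apply: (@pform_span0 [:: g11; g12; g21; g22]).
    by move=> g /orthE[h1 h2]; move: hw; rewrite !inE => /orP[] /eqP->.
  by do !apply: in_spanD; apply/in_spanZ/in_span_mem; rewrite !inE eqxx ?orbT.
move=> u v /twL_comb2P[p ->] /twL_comb2P[q ->].
by rewrite !Jq_comb2 !wedge_comb2_same !pformZr !orth ?mulr0 // !inE eqxx ?orbT.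
Qed.

(** Of the six basic bivectors, [wedge e1 e2] and [wedge f1 f2] pair only with each other.
    Orthogonality to both therefore removes both coordinates, and isotropy makes the remaining four
    a Segre point. *)
Lemma Q2S_segreP a : Q2S S a ->
  exists x y, [/\ x != (0, 0), y != (0, 0) & a = twistor_segre x y].
Proof.
case=> a0 aa orth; have [h1 h2 _] := F.
have [orth1 orth2] := orth _ _ h1 h2.
suff /(isotropic_segre twistor_segre_form) : in_span [:: g11; g12; g21; g22] a.
  move/(_ aa) => [x [y e]]; move: a0; rewrite e (segre_neq0 twistor_segre_form).
  by case/andP => x0 y0; exists x, y.
have : in_span [:: wedge e1 e2; wedge f1 f2; g11; g12; g21; g22] a.
  apply: (@bivector_span _ us) => [|u v]; first exact: frame_span.
  have M g : g \in [:: wedge e1 e2; wedge f1 f2; g11; g12; g21; g22] ->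
      forall k : C, in_span [:: wedge e1 e2; wedge f1 f2; g11; g12; g21; g22] (k *: g).
    by move=> hg k; apply/in_spanZ/in_span_mem.
  have P u' v' : wedge u' v' \in [:: wedge e1 e2; wedge f1 f2; g11; g12; g21; g22] ->
      in_span [:: wedge e1 e2; wedge f1 f2; g11; g12; g21; g22] (wedge u' v') /\
      in_span [:: wedge e1 e2; wedge f1 f2; g11; g12; g21; g22] (wedge v' u').
    move=> h; split; first exact: in_span_mem.
    by rewrite (wedgeC v') -scaleN1r; apply: M.
  have Z u' : in_span [:: wedge e1 e2; wedge f1 f2; g11; g12; g21; g22] (wedge u' u').
    by rewrite wedgexx; exact: in_span0.
  have P12 := P e1 e2 ltac:(by rewrite !inE eqxx ?orbT).
  have P34 := P f1 f2 ltac:(by rewrite !inE eqxx ?orbT).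
  have P13 := P e1 f1 ltac:(by rewrite !inE eqxx ?orbT).
  have P14 := P e1 f2 ltac:(by rewrite !inE eqxx ?orbT).
  have P23 := P e2 f1 ltac:(by rewrite !inE eqxx ?orbT).
  have P24 := P e2 f2 ltac:(by rewrite !inE eqxx ?orbT).
  rewrite [u \in _]inE ![u \in _ :: _]inE [v \in _]inE ![v \in _ :: _]inE.
  move=> /or4P[] /eqP-> /or4P[] /eqP->; rewrite ?Z //;
  by [case: P12 | case: P34 | case: P13 | case: P14 | case: P23 | case: P24].
move=> /in_span_cons[al [a' [/in_span_cons[be [a'' [ha ->]]] ea]]].
have [z1 z2] : pform a'' (wedge e1 e2) = 0 /\ pform a'' (wedge f1 f2) = 0.
  by split; apply: pform_span0 ha => g /orthE[].
have [s1 _ _ _] := pform_wedge_shared e1 e2 e2.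
have [s2 _ _ _] := pform_wedge_shared f1 f2 f2.
have k0 := twistor_kap_neq0.
move: orth1 orth2; rewrite ea !(pformDl, pformZl) s1 s2 z1 z2 pform_E.
rewrite (pformC (wedge e1 e2)) pform_E !mulr0 !addr0 !add0r => h3 h4.
have al0 : al = 0.
  by apply: (mulIf k0); rewrite mul0r; apply/eqP; rewrite -oppr_eq0 -mulrN h4.
have be0 : be = 0.
  by apply: (mulIf k0); rewrite mul0r; apply/eqP; rewrite -oppr_eq0 -mulrN h3.
by rewrite al0 be0 !scale0r !add0r.
Qed.

Lemma piS_segre x y : x != (0, 0) -> piS S (twistor_segre x y) (comb2 e1 e2 x).
Proof.
move=> x0; split; [by rewrite comb2_neq0 | exact: twL_comb2 |].
by exists (comb2 f1 f2 y); rewrite wedge_twistor.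
Qed.

(** A line through [v] is orthogonal to every wedge with factor [v]; pairing with one whose second
    component differs from [y] forces the first component of [v] to be [x]. *)
Lemma piS_segreP x y v : x != (0, 0) -> y != (0, 0) ->
  piS S (twistor_segre x y) v -> exists2 k, k != 0 &
    v = comb2 e1 e2 (k * x.1, k * x.2).
Proof.
move=> x0 y0 [v0 /twL_comb2P[z ez] [w ew]].
have [y' hy] := det2_ndeg y0.
have [h _ _ _] := pform_wedge_shared v w (comb2 f1 f2 y').
move/eqP: h; rewrite -ew ez wedge_twistor /twistor_segre.
case: (twistor_segre_form) => k0 ->.
rewrite !mulf_eq0 (negPf k0) (negPf hy) orbF /= => /eqP d.
have d' : det2 z x = 0 by rewrite det2C d oppr0.
have [k hk] := det2_eq0 x0 d'; exists k; last by rewrite hk.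
by apply: contraNneq v0 => k0'; rewrite ez hk k0' /comb2 /= !mul0r !scale0r addr0.
Qed.

End Frame.
End TwistorFrame.

(** * Nets in [Q^2_S] *)

Section SegreNet.
Context {C : numClosedFieldType} {g11 g12 g21 g22 : 'cV[C]_6} {kap : C}.
Hypothesis H : segre_form g11 g12 g21 g22 kap.
Local Notation sg := (segre g11 g12 g21 g22).
Implicit Types (X Y : int -> int -> C * C) (lam : C) (c : C * C).

Definition crFace X m n : C * C :=
  cr (X (m + 1) n) (X m n) (X m (n + 1)) (X (m + 1) (n + 1)).

Definition spread (x1 x2 x3 : C * C) :=
  [/\ det2 x1 x2 != 0, det2 x1 x3 != 0 & det2 x2 x3 != 0].

Definition fourthFace lam X m n : C * C :=
  fourth lam (X (nearc m) (nearc n)) (X (farc m) (nearc n)) (X (nearc m) (farc n)).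

Definition spreadFace X m n :=
  spread (X (farc m) (nearc n)) (X (nearc m) (nearc n)) (X (nearc m) (farc n)).

Lemma irredConic_spread X Y m n :
  irredConic (nearV (fun k l => sg (X k l) (Y k l)) m n) ->
  spreadFace X m n /\ spreadFace Y m n.
Proof.
move/(irredConic_eq_mem (nearV_orient _ m n))/irredConic_frame.
case; do ?exact: segre_isotropic H _ _.
by move=> _; rewrite !(pform_segre_neq0 H) => -[/andP[? ?] /andP[? ?] /andP[? ?]].
Qed.

Lemma crFace_fourth lam X m n : spreadFace X m n -> X (farc m) (farc n) != (0, 0) ->
  peq1 (crFace X m n) (lam, 1) -> exists2 k, k != 0 &
    X (farc m) (farc n) = (k * (fourthFace lam X m n).1, k * (fourthFace lam X m n).2).
Proof. by rewrite /crFace cr_orient => -[d12 d13 _] nz /fourth_uniq; apply. Qed.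

Lemma crFace_lines (a b : 'cV[C]_4) X m n c : indep2 a b ->
  crLine (comb2 a b (X (m + 1) n)) (comb2 a b (X m n)) (comb2 a b (X m (n + 1)))
    (comb2 a b (X (m + 1) (n + 1))) c <-> peq1 (crFace X m n) c.
Proof. exact: crLine_comb. Qed.

Section Net.
Variables X Y : int -> int -> C * C.
Hypothesis nz : forall k l, sg (X k l) (Y k l) != 0.
Let phi k l := sg (X k l) (Y k l).

Let face_nz m n : 0 \notin faceV phi m n.
Proof. by rewrite !inE !negb_or ![0 == _]eq_sym !nz. Qed.

Lemma steinerFace_cr m n c : conicFace phi m n -> steinerFace phi m n c ->
  peq1 (crFace X m n) c.
Proof. by case=> cop irr; exact: (steiner_segre H (face_nz m n) cop irr). Qed.

Lemma cr_steinerFace m n c : conicFace phi m n -> peq1 (crFace X m n) c ->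
  steinerFace phi m n c.
Proof. by case=> cop irr; exact: (segre_steiner H (face_nz m n) cop irr). Qed.

Lemma crFace_neq0 m n : conicFace phi m n -> crFace X m n != (0, 0).
Proof. by case=> cop irr; exact: (segre_cr_neq0 H (face_nz m n) cop irr). Qed.

Lemma conicFace_fourth lam m n k k' :
  let x := fourthFace lam X m n in let y := fourthFace lam Y m n in
  X (farc m) (farc n) = (k * x.1, k * x.2) ->
  Y (farc m) (farc n) = (k' * y.1, k' * y.2) ->
  irredConic (nearV phi m n) -> conicFace phi m n.
Proof.
move=> x y hX hY irr; split.
  apply/coplanar_orient; rewrite /orientedFace {4}/phi hX hY.
  exact: segre_fourth_coplanar.
apply: irredConic_sub irr => v hv; apply: in_span_mem; rewrite faceV_orient.
by move: hv; rewrite nearV_orient !inE => /or3P[] ->; rewrite ?orbT.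
Qed.

End Net.

(** The Steiner cross-ratio does not see the order of the two rulings, so the first-factor result
    applies after exchanging them. *)
Lemma steinerFace_cr2 X Y m n c : (forall k l, sg (X k l) (Y k l) != 0) ->
  let phi k l := sg (X k l) (Y k l) in
  conicFace phi m n -> steinerFace phi m n c -> peq1 (crFace Y m n) c.
Proof.
move=> nz phi; pose phi' k l := segre g11 g21 g12 g22 (Y k l) (X k l).
have e k l : phi k l = phi' k l by rewrite /phi' segre_swap.
have nz' k l : phi' k l != 0 by rewrite -e; exact: nz.
rewrite /conicFace /steinerFace /faceV /= !e.
move=> [cop irr]; apply: (@steiner_segre _ _ _ _ _ _ (segre_form_swap H)) => //.
by rewrite !inE !negb_or ![0 == _]eq_sym !nz'.
Qed.

End SegreNet.

Section Nets.
Context {C : numClosedFieldType}.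

Lemma fourthZ (lam k1 k2 k3 : C) (z1 z2 z3 : C * C) :
  let w := fourth lam z2 z1 z3 in
  fourth lam (k2 * z2.1, k2 * z2.2) (k1 * z1.1, k1 * z1.2) (k3 * z3.1, k3 * z3.2) =
  (k1 * k2 * k3 * w.1, k1 * k2 * k3 * w.2).
Proof. by rewrite /fourth /det2 /=; congr pair; ring. Qed.

Lemma peq_sym {n} (u v : 'cV[C]_n) : peq u v -> peq v u.
Proof.
move=> [u0 [v0 [t e]]]; do 2!split=> //; exists t^-1.
rewrite e scalerA mulVf ?scale1r //.
by apply: contraNneq u0 => t0; rewrite e t0 scale0r.
Qed.

Lemma peq_trans {n} (u v w : 'cV[C]_n) : peq u v -> peq v w -> peq u w.
Proof.
move=> [u0 [_ [t eu]]] [_ [w0 [s ev]]]; do 2!split=> //.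
by exists (t * s); rewrite eu ev scalerA.
Qed.

Lemma peq_realpt (u v : 'cV[C]_4) : realpt u != 0 -> peq u v ->
  peq (realpt u) (realpt v).
Proof.
move=> u0 [_ [_ [t e]]].
have h : realpt u = (t * t^*) *: realpt v.
  by rewrite /realpt e JqZ wedgeZl wedgeZr scalerA.
do 2!split=> //; last by exists (t * t^*).
by apply: contraNneq u0 => v0; rewrite h v0 scaler0.
Qed.

(** Decidable equality in [U] and choice in [T] allow coordinates to be picked for a whole net
    without an axiom. *)
Lemma choice2 {T : choiceType} {U : eqType} (f : T -> U) (a : int -> int -> U) :
  (forall k l, exists x, a k l = f x) ->
  exists X : int -> int -> T, forall k l, a k l = f (X k l).
Proof.
move=> h; have h' k l : exists x, a k l == f x by have [x ->] := h k l; exists x.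
by exists (fun k l => xchoose (h' k l)) => k l; apply/eqP/(xchooseP (h' k l)).
Qed.

End Nets.

Section NetExt.
Context {C : numClosedFieldType} (S : 'M[C]_4).
Implicit Types (phi : int -> int -> 'cV[C]_6).

Definition boundary (p : int -> 'cV[C]_4) (psi : int -> int -> 'cV[C]_4) phi :=
  (forall k, peq (phi k 0) (realpt (p k))) /\
  (forall n, peq (phi 0 n) (realpt (psi 0 n))).

Definition goodFace (lam : C) phi m n :=
  conicFace phi m n /\ steinerFace phi m n (lam, 1).

(** Here [phi] is total but only required to be good on the faces preceding [(m, n)], so the
    condition can be invoked inside the face induction. *)
Definition irredSteps (p : int -> 'cV[C]_4) psi (lam : C) :=
  forall (m n : int) phi, (forall k n, Q2S S (phi k n)) -> boundary p psi phi ->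
    (forall m' n', inRect m' n' m n -> (m', n') != (m, n) -> goodFace lam phi m' n') ->
    irredConic (nearV phi m n).

Lemma nearV_ext phi phi' m n : (forall k l, phi k l = phi' k l) ->
  nearV phi m n = nearV phi' m n.
Proof. by move=> e; apply: eq_map => kl; exact: e. Qed.

Lemma goodFace_ext (lam : C) phi phi' m n : (forall k l, phi k l = phi' k l) ->
  goodFace lam phi m n -> goodFace lam phi' m n.
Proof. by move=> e; rewrite /goodFace /conicFace /steinerFace /faceV /= !e. Qed.

End NetExt.

(** * Conic nets with prescribed real points on the axes *)

Section CauchyProblem.
Context {C : numClosedFieldType} (S : 'M[C]_4).
Hypothesis HS : quat_cpx_str S.
Variables e1 e2 : 'cV[C]_4.
Hypothesis F : twistor_frame S e1 e2.
Local Notation sg := (twistor_segre e1 e2).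
Let HF := twistor_segre_form HS F.
Implicit Types (phi : int -> int -> 'cV[C]_6) (X Y : int -> int -> C * C).

Lemma twistor_segre_neq0 x y : (sg x y != 0) = (x != (0, 0)) && (y != (0, 0)).
Proof. exact: segre_neq0 HF _ _. Qed.

Lemma Q2S_net phi : (forall k n, Q2S S (phi k n)) -> exists X Y,
  forall k n, [/\ X k n != (0, 0), Y k n != (0, 0) & phi k n = sg (X k n) (Y k n)].
Proof.
move=> h; have [|Z hZ] := @choice2 (C * C * (C * C))%type _ (fun z => sg z.1 z.2) phi.
  by move=> k n; have [x [y [_ _ ->]]] := Q2S_segreP HS F (h k n); exists (x, y).
exists (fun k n => (Z k n).1), (fun k n => (Z k n).2) => k n.
have [+ _ _] := h k n; rewrite hZ.
by rewrite twistor_segre_neq0 => /andP[].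
Qed.

Lemma piS_crLine phi m n (x1 x2 x3 x4 : 'cV[C]_4) :
  (forall k l, Q2S S (phi k l)) -> conicFace phi m n ->
  piS S (phi (m + 1) n) x1 -> piS S (phi m n) x2 ->
  piS S (phi m (n + 1)) x3 -> piS S (phi (m + 1) (n + 1)) x4 ->
  (exists c, steinerFace phi m n c) /\
  (forall c, steinerFace phi m n c -> crLine x1 x2 x3 x4 c).
Proof.
move=> hQ hc p1 p2 p3 p4; have [X [Y h]] := Q2S_net hQ.
pose phi' k l := sg (X k l) (Y k l).
have e k l : phi k l = phi' k l by have [] := h k l.
have nz k l : phi' k l != 0 by rewrite -e; have [] := hQ k l.
have hc' : conicFace phi' m n by move: hc; rewrite /conicFace /faceV /= !e.
have hs c : steinerFace phi m n c <-> steinerFace phi' m n c.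
  by rewrite /steinerFace !e.
have lift k l v : piS S (phi k l) v ->
    exists2 t, t != 0 & v = comb2 e1 e2 (t * (X k l).1, t * (X k l).2).
  by have [a b ->] := h k l; exact: (piS_segreP HS F).
have [t1 n1 ->] := lift _ _ _ p1; have [t2 n2 ->] := lift _ _ _ p2.
have [t3 n3 ->] := lift _ _ _ p3; have [t4 n4 ->] := lift _ _ _ p4.
have key c : steinerFace phi m n c <-> peq1 (crFace X m n) c.
  by rewrite hs; split; [exact: (steinerFace_cr HF nz) | exact: (cr_steinerFace HF nz)].
split.
  exists (crFace X m n); apply/key; have nc := crFace_neq0 HF nz hc'.
  by do 2!split=> //; exact: mulrC.
move=> c /key hX; have [_ _ ind] := F; apply/(crLine_comb _ _ _ _ _ ind).
have T (t t' : C) (x x' : C * C) :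
    t * t' * det2 x x' = 1 * det2 (t * x.1, t * x.2) (t' * x'.1, t' * x'.2).
  by rewrite /det2 /=; ring.
exact: (iffLR (peq1_cr_transfer c n1 n2 n3 n4 (oner_neq0 C)
  (T _ _ _ _) (T _ _ _ _) (T _ _ _ _) (T _ _ _ _)) hX).
Qed.

Lemma cauchy_exists (p : int -> 'cV[C]_4) (lam : C) (psi : int -> int -> 'cV[C]_4) :
  (forall k n, psi k n != 0 /\ twL S (psi k n)) ->
  (forall k, peq (psi k 0) (p k)) ->
  (forall k n, crLine (psi (k + 1) n) (psi k n) (psi k (n + 1))
                      (psi (k + 1) (n + 1)) (lam, 1)) ->
  irredSteps S p psi lam ->
  exists phi, [/\ forall k n, Q2S S (phi k n), forall k n, goodFace lam phi k n,
    boundary p psi phi &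
    forall k n, exists x, piS S (phi k n) x /\ peq x (psi k n)].
Proof.
move=> hpsi hp hcr irr.
have [X hX] : exists X, forall k n, psi k n = comb2 e1 e2 (X k n).
  by apply: choice2 => k n; have [_ /(twL_comb2P HS F)] := hpsi k n.
have X0 k n : X k n != (0, 0).
  by have [+ _] := hpsi k n; rewrite hX (comb2_neq0 F).
(* The default keeps every vertex in [Q^2_S], as the irreducibility hypothesis demands, before any
   face is known to be nondegenerate. *)
pose nonzero z : C * C := if z == (0, 0) then (1, 0) else z.
pose step (m n : int) (z1 z2 z3 : C * C) := nonzero (fourth lam z2 z1 z3).
have [Y [Yh Yv Yf]] := @goursat _ (fun k => conj2 (X k 0)) (fun n => conj2 (X 0 n))
  step erefl.
have Y0 : forall k n, Y k n != (0, 0).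
  apply: vertex_ind => [k|n|m n _ _ _]; rewrite ?Yh ?Yv ?Yf; try exact: conj2_neq0.
  rewrite /step /nonzero; case: ifPn => // _.
  by rewrite pair_neq0 /= oner_eq0.
pose phi k n := sg (X k n) (Y k n).
have nz k n : phi k n != 0 by rewrite twistor_segre_neq0 X0 Y0.
have hQ k n : Q2S S (phi k n) by exact: (Q2S_segre HS F (X0 k n) (Y0 k n)).
have hreal k n : Y k n = conj2 (X k n) -> phi k n = realpt (psi k n).
  by move=> e; rewrite /phi e hX realpt_twistor.
have hb : boundary p psi phi.
  split=> k.
    by rewrite hreal ?Yh //; apply: peq_realpt (hp k); rewrite -hreal ?Yh.
  rewrite -hreal ?Yv //; do 2!split=> //.
  by exists 1; rewrite scale1r.
have hcX m n : peq1 (crFace X m n) (lam, 1).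
  have [_ _ ind] := F; apply/(crFace_lines _ _ _ _ ind); rewrite -!hX; exact: hcr.
have good : forall m n, goodFace lam phi m n.
  apply: face_ind => m n IH; have hirr := irr m n phi hQ hb IH.
  have [sX sY] := irredConic_spread HF hirr.
  have [k k0 hk] := crFace_fourth sX (X0 _ _) (hcX m n).
  (* Irreducibility separates the three near vertices in the second factor, so [fourth] is nonzero
     and the default is not taken. *)
  have hY : Y (farc m) (farc n) =
      (1 * (fourthFace lam Y m n).1, 1 * (fourthFace lam Y m n).2).
    rewrite !mul1r -surjective_pairing Yf /step /nonzero ifN //.
    by have [? ? _] := sY; apply: fourth_neq0.
  have hc := conicFace_fourth hk hY hirr.
  by split=> //; exact: (cr_steinerFace HF nz hc (hcX m n)).
exists phi; split=> // k n; exists (psi k n); split.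
  by rewrite hX; exact: (piS_segre F _ (X0 k n)).
have [h _] := hpsi k n; do 2!split=> //.
by exists 1; rewrite scale1r.
Qed.

Lemma cauchy_unique (p : int -> 'cV[C]_4) (lam : C) (psi : int -> int -> 'cV[C]_4)
    phi phi' :
  irredSteps S p psi lam ->
  (forall k n, Q2S S (phi k n)) -> (forall k n, goodFace lam phi k n) ->
  boundary p psi phi ->
  (forall k n, Q2S S (phi' k n)) -> (forall k n, goodFace lam phi' k n) ->
  boundary p psi phi' ->
  forall k n, peq (phi' k n) (phi k n).
Proof.
move=> irr hQ hg hb hQ' hg' hb'.
have [X [Y hXY]] := Q2S_net hQ; have [X' [Y' hXY']] := Q2S_net hQ'.
have main (Z : int -> int -> 'cV[C]_6) (A B : int -> int -> C * C) :
    (forall k n, [/\ A k n != (0, 0), B k n != (0, 0) & Z k n = sg (A k n) (B k n)]) ->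
    (forall k n, Q2S S (Z k n)) -> (forall k n, goodFace lam Z k n) ->
    boundary p psi Z -> forall m n,
    [/\ spreadFace A m n, spreadFace B m n, peq1 (crFace A m n) (lam, 1) &
        peq1 (crFace B m n) (lam, 1)].
  move=> hZ hQZ hgZ hbZ m n; have hirr := irr m n Z hQZ hbZ (fun _ _ _ _ => hgZ _ _).
  have e k l : Z k l = sg (A k l) (B k l) by have [] := hZ k l.
  have nz k l : sg (A k l) (B k l) != 0 by rewrite -e; have [] := hQZ k l.
  have [sA sB] : spreadFace A m n /\ spreadFace B m n.
    by apply: (irredConic_spread HF); rewrite -(nearV_ext m n e).
  have [hc hs] := goodFace_ext e (hgZ m n).
  split=> //; first exact: (steinerFace_cr HF nz hc hs).
  exact: (steinerFace_cr2 HF nz hc hs).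
have m1 := main _ _ _ hXY hQ hg hb; have m2 := main _ _ _ hXY' hQ' hg' hb'.
(* [fourth] is homogeneous in each of its three points, so proportional near vertices give
   proportional far ones. *)
have far_prop (A A' : int -> int -> C * C) m n :
    spreadFace A m n -> spreadFace A' m n ->
    peq1 (crFace A m n) (lam, 1) -> peq1 (crFace A' m n) (lam, 1) ->
    (forall k l, A k l != (0, 0)) -> (forall k l, A' k l != (0, 0)) ->
    det2 (A' (farc m) (nearc n)) (A (farc m) (nearc n)) = 0 ->
    det2 (A' (nearc m) (nearc n)) (A (nearc m) (nearc n)) = 0 ->
    det2 (A' (nearc m) (farc n)) (A (nearc m) (farc n)) = 0 ->
    exists k, A' (farc m) (farc n) =
      (k * (A (farc m) (farc n)).1, k * (A (farc m) (farc n)).2).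
  move=> sA sA' cA cA' A0 A0' d1 d2 d3; apply: det2_eq0 => //.
  have [k k0 ->] := crFace_fourth sA (A0 _ _) cA.
  have [k' k0' ->] := crFace_fourth sA' (A0' _ _) cA'.
  have [k1 e1'] := det2_eq0 (A0 _ _) d1; have [k2 e2'] := det2_eq0 (A0 _ _) d2.
  have [k3 e3'] := det2_eq0 (A0 _ _) d3.
  by rewrite /fourthFace e1' e2' e3' fourthZ /det2 /=; ring.
have X0 k n : X k n != (0, 0) by have [] := hXY k n.
have Y0 k n : Y k n != (0, 0) by have [] := hXY k n.
have X0' k n : X' k n != (0, 0) by have [] := hXY' k n.
have Y0' k n : Y' k n != (0, 0) by have [] := hXY' k n.
have hE k n : phi k n = sg (X k n) (Y k n) by have [] := hXY k n.
have hE' k n : phi' k n = sg (X' k n) (Y' k n) by have [] := hXY' k n.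
apply: vertex_ind => [k|n|m n].
- by apply: peq_trans (proj1 hb' k) (peq_sym (proj1 hb k)).
- by apply: peq_trans (proj2 hb' n) (peq_sym (proj2 hb n)).
rewrite !hE !hE' => /(segre_peq HF)[dx1 dy1] /(segre_peq HF)[dx2 dy2].
move=> /(segre_peq HF)[dx3 dy3].
have [sX sY cX cY] := m1 m n; have [sX' sY' cX' cY'] := m2 m n.
have [s es] := far_prop _ _ _ _ sX sX' cX cX' X0 X0' dx1 dx2 dx3.
have [t et] := far_prop _ _ _ _ sY sY' cY cY' Y0 Y0' dy1 dy2 dy3.
split; first by rewrite twistor_segre_neq0 X0' Y0'.
split; first by rewrite twistor_segre_neq0 X0 Y0.
by exists (s * t); rewrite es et; exact: segreZ.
Qed.

End CauchyProblem.

Theorem mainTheorem1 (C : numClosedFieldType) (S : 'M[C]_4) :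
  quat_cpx_str S ->
  (* (a) *)
  (forall phi : int -> int -> 'cV[C]_6,
     (forall m n, Q2S S (phi m n)) ->
     (forall m n, conicFace phi m n) ->
     forall (m n : int) (x1 x2 x3 x4 : 'cV[C]_4),
       piS S (phi (m + 1) n) x1 -> piS S (phi m n) x2 ->
       piS S (phi m (n + 1)) x3 -> piS S (phi (m + 1) (n + 1)) x4 ->
       (exists c, steinerFace phi m n c) /\
       (forall c, steinerFace phi m n c -> crLine x1 x2 x3 x4 c))
  /\
  (* (b) *)
  (forall (p : int -> 'cV[C]_4) (lam : C) (psi : int -> int -> 'cV[C]_4),
     (forall k, p k != 0 /\ twL S (p k)) ->
     (forall k n, psi k n != 0 /\ twL S (psi k n)) ->
     (forall k, peq (psi k 0) (p k)) ->
     (forall k n, crLine (psi (k + 1) n) (psi k n) (psi k (n + 1))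
                         (psi (k + 1) (n + 1)) (lam, 1)) ->
     let boundary (phi : int -> int -> 'cV[C]_6) :=
       (forall k, peq (phi k 0) (realpt (p k))) /\
       (forall n, peq (phi 0 n) (realpt (psi 0 n))) in
     let goodNet (phi : int -> int -> 'cV[C]_6) :=
       (forall k n, Q2S S (phi k n)) /\
       (forall k n, conicFace phi k n /\ steinerFace phi k n (lam, 1)) in
     (* the face conics encountered in the construction are irreducible *)
     (forall (m n : int) (phi' : int -> int -> 'cV[C]_6),
        (forall k n, Q2S S (phi' k n)) -> boundary phi' ->
        (forall m' n', inRect m' n' m n -> (m', n') != (m, n) ->
           conicFace phi' m' n' /\ steinerFace phi' m' n' (lam, 1)) ->
        irredConic (nearV phi' m n)) ->
     exists phi : int -> int -> 'cV[C]_6,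
       [/\ goodNet phi, boundary phi,
           (forall k n, exists x, piS S (phi k n) x /\ peq x (psi k n)) &
           (forall phi', goodNet phi' -> boundary phi' ->
              forall k n, peq (phi' k n) (phi k n))]).
Proof.
move=> HS; have [e1 [e2 F]] := twistor_frame_exists HS; split.
  by move=> phi hQ hc m n x1 x2 x3 x4; exact: (piS_crLine HS F hQ (hc m n)).
move=> p lam psi hp hpsi hpp hcr bd goodNet irr.
have [phi [hQ hg hb hpi]] := cauchy_exists HS F hpsi hpp hcr irr.
exists phi; split=> //.
by move=> phi' [hQ' hg'] hb'; exact: (cauchy_unique HS F irr hQ hg hb hQ' hg' hb').
Qed.
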